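(* Let $f=\frac1n\sum_{i=1}^n f_i$ with $f_i:\mathbb{R}^d\to\mathbb{R}$ differentiable (not necessarily convex). Suppose $f$ is $L$-smooth, each $f_i$ is $L_i$-smooth with $L_{\max}=\max_iL_i$, and there exist $f^*,f_1^*,\dots,f_n^*\in\mathbb{R}$ with $f(x)\ge f^*$ and $f_i(x)\ge f_i^*$ for all $x\in\mathbb{R}^d$ and all $i\in\{1,\dots,n\}$. Put $\Delta_0:=f(x^0)-f^*$ and $\Delta^*:=f^*-\frac1n\sum_{i=1}^nf_i^*$. Let $\varepsilon>0$. Consider the algorithm EF21-P + DCGD (described in the context) with compressors $\mathcal{C}_i^D\in\mathbb{U}(\omega)$, $\mathcal{C}^P\in\mathbb{B}(\alpha)$, with $x^0=w^0$ and $$\gamma=\min\left\{\frac{\alpha}{8L},\ \frac{\sqrt n}{\sqrt{2\omega LL_{\max}T}},\ \frac{n\varepsilon}{32\Delta^*\omega LL_{\max}}\right\}.$$ If the number of iterations satisfies $$T\ge\frac{48\Delta_0L}{\varepsilon}\max\left\{\frac8\alpha,\ \frac{96\Delta_0\omega L_{\max}}{n\varepsilon},\ \frac{32\Delta^*\omega L_{\max}}{n\varepsilon}\right\},$$ then $$\min_{0\le t\le T-1}\mathrm{E}\left[\|\nabla f(x^t)\|^2\right]\le\varepsilon .$$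
   Context: $\|\cdot\|$ is the Euclidean norm. A function $\varphi$ is $L$-smooth if it is differentiable with $\|\nabla \varphi(x)-\nabla \varphi(y)\|\le L\|x-y\|$ for all $x,y\in\mathbb{R}^d$; the constants $L$ and $L_i$ denote the smallest such numbers for $f$ and $f_i$. Fractions with zero denominator in the stepsize formula are read as $+\infty$. Compressors. For $\alpha\in(0,1]$, $\mathbb{B}(\alpha)$ is the set of (possibly) stochastic mappings $\mathcal{C}:\mathbb{R}^d\to\mathbb{R}^d$ with $\mathrm{E}[\|\mathcal{C}(x)-x\|^2]\le(1-\alpha)\|x\|^2$ for all $x\in\mathbb{R}^d$. For $\omega\ge0$, $\mathbb{U}(\omega)$ is the set of stochastic mappings $\mathcal{C}:\mathbb{R}^d\to\mathbb{R}^d$ with $\mathrm{E}[\mathcal{C}(x)]=x$ and $\mathrm{E}[\|\mathcal{C}(x)-x\|^2]\le\omega\|x\|^2$ for all $x\in\mathbb{R}^d$. Algorithm EF21-P + DCGD. Parameters: learning rate $\gamma>0$, initial iterate $x^0\in\mathbb{R}^d$, initial iterate shift $w^0=x^0$. For $t=0,1,\dots,T-1$: $g_i^t=\mathcal{C}_i^D(\nabla f_i(w^t))$ for $i=1,\dots,n$; $g^t=\frac1n\sum_{i=1}^n g_i^t$; $x^{t+1}=x^t-\gamma g^t$; $w^{t+1}=w^t+\mathcal{C}^P(x^{t+1}-w^t)$. *)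

(* Defs.v *)
From mathcomp Require Import all_boot all_order all_algebra.
From mathcomp Require Import all_classical all_reals all_analysis.

Set Implicit Arguments.
Unset Strict Implicit.
Unset Printing Implicit Defensive.

Import Order.TTheory GRing.Theory Num.Theory.
Import numFieldNormedType.Exports.

Local Open Scope classical_set_scope.
Local Open Scope ring_scope.

(* The library norm `|x| of 'rV[R]_d is the sup norm, hence this definition. *)
Definition enorm (R : realType) (d : nat) (x : 'rV[R]_d) : R :=
  Num.sqrt (\sum_(j < d) x ord0 j ^+ 2).

Definition grad (R : realType) (d : nat) (phi : 'rV[R]_d -> R)
    (x : 'rV[R]_d) : 'rV[R]_d :=
  \row_(j < d) 'D_(delta_mx ord0 j) phi x.

Definition smooth (R : realType) (d : nat) (L : R) (phi : 'rV[R]_d -> R) :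
    Prop :=
  (forall x, differentiable phi x) /\
  (forall x y, enorm (grad phi x - grad phi y) <= L * enorm (x - y)).

Definition smoothness_constant (R : realType) (d : nat)
    (phi : 'rV[R]_d -> R) (L : R) : Prop :=
  smooth L phi /\ (forall M, smooth M phi -> L <= M).

Definition average (R : realType) (d n : nat) (f : 'I_n -> 'rV[R]_d -> R)
    (x : 'rV[R]_d) : R :=
  n%:R^-1 * \sum_(i < n) f i x.

(* The Borel sigma-algebra; the library puts no measurable structure on
   matrices. *)
Definition borel_rV (R : realType) (d : nat) :=
  g_sigma_algebraType (@open 'rV[R]_d).

(* A stochastic mapping R^d -> R^d is a deterministic, jointly measurable
   function of its argument and of a random seed drawn according to [law]. *)
Record stoch_map (R : realType) (d : nat) := StochMap {
  seed_display : measure_display ;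
  seed : measurableType seed_display ;
  law : probability seed R ;
  act : seed -> 'rV[R]_d -> 'rV[R]_d ;
  act_measurable :
    measurable_fun [set: seed * borel_rV R d]
      (fun p => act p.1 p.2 : borel_rV R d)
}.
Arguments act {R d} s _ _.

(* B(alpha) and U(omega) are predicates because [set (stoch_map R d)] is
   universe inconsistent. *)
Definition biased_compressor (R : realType) (d : nat) (alpha : R)
    (C : stoch_map R d) : Prop :=
  forall x : 'rV[R]_d,
    ('E_(law C)[(fun s => (enorm (act C s x - x) ^+ 2)%R)]
       <= ((1 - alpha) * enorm x ^+ 2)%R%:E)%E.

(* The vector identity E[C(x)] = x is stated coordinatewise. *)
Definition unbiased_compressor (R : realType) (d : nat) (omega : R)
    (C : stoch_map R d) : Prop :=
  forall x : 'rV[R]_d,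
    (forall j, ('E_(law C)[(fun s => act C s x ord0 j)] = (x ord0 j)%:E)%E) /\
    ('E_(law C)[(fun s => (enorm (act C s x - x) ^+ 2)%R)]
       <= (omega * enorm x ^+ 2)%R%:E)%E.

Definition mutually_independent (R : realType) (d : measure_display)
    (Omega : measurableType d) (P : probability Omega R) (I : finType)
    (F : I -> set (set Omega)) : Prop :=
  forall (J : {set I}) (A : I -> set Omega),
    (forall k, k \in J -> F k (A k)) ->
    P (\bigcap_(k in [set` J]) A k) = (\prod_(k in J) P (A k))%E.

(* The events determined by the seed used at step t by worker i (k = Some i)
   or by the compressor of the iterates (k = None). *)
Definition seed_events (R : realType) (d n : nat) (dO : measure_display)
    (Omega : measurableType dO) (CD : 'I_n -> stoch_map R d)
    (CP : stoch_map R d)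
    (xiD : nat -> forall i, Omega -> seed (CD i))
    (xiP : nat -> Omega -> seed CP)
    (t : nat) (k : option 'I_n) : set (set Omega) :=
  match k with
  | Some i => preimage_set_system setT (xiD t i) measurable
  | None => preimage_set_system setT (xiP t) measurable
  end.

(* During the first T steps every call of a compressor uses a fresh seed: it
   has the prescribed law, and all the seeds are mutually independent. *)
Definition fresh_seeds (R : realType) (d n : nat) (dO : measure_display)
    (Omega : measurableType dO) (P : probability Omega R)
    (CD : 'I_n -> stoch_map R d) (CP : stoch_map R d)
    (xiD : nat -> forall i, {RV P >-> seed (CD i)})
    (xiP : nat -> {RV P >-> seed CP}) (T : nat) : Prop :=
  [/\ forall (t : 'I_T) (i : 'I_n) (A : set (seed (CD i))), measurable A ->
        distribution P (xiD t i) A = law (CD i) A,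
      forall (t : 'I_T) (A : set (seed CP)), measurable A ->
        distribution P (xiP t) A = law CP A
    & mutually_independent P (fun tk : 'I_T * option 'I_n =>
        seed_events (fun t i => xiD t i : Omega -> _)
          (fun t => xiP t : Omega -> _) tk.1 tk.2)].

(* EF21-P + DCGD: the pair (x^t, w^t). *)
Fixpoint ef21p_dcgd (R : realType) (d n : nat) (Omega : Type)
    (f : 'I_n -> 'rV[R]_d -> R)
    (CD : 'I_n -> stoch_map R d) (CP : stoch_map R d)
    (xiD : nat -> forall i, Omega -> seed (CD i))
    (xiP : nat -> Omega -> seed CP)
    (gamma : R) (x0 : 'rV[R]_d) (t : nat) (om : Omega) :
    'rV[R]_d * 'rV[R]_d :=
  match t with
  | 0%N => (x0, x0)
  | t'.+1 =>
      let: (x, w) := ef21p_dcgd f xiD xiP gamma x0 t' om in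
      let g := n%:R^-1 *:
        \sum_(i < n) act (CD i) (xiD t' i om) (grad (f i) w) in
      let x' := x - gamma *: g in
      (x', w + act CP (xiP t' om) (x' - w))
  end.

Definition efrac (R : realType) (a b : R) : \bar R :=
  if b == 0 then +oo%E else (a / b)%:E.

(* Main.v *)
Require Import Defs.
From HB Require Import structures.
From mathcomp Require Import all_boot all_order all_algebra.
From mathcomp Require Import all_classical all_reals all_analysis.
From mathcomp Require Import measurable_realfun ring lra.

Set Implicit Arguments.
Unset Strict Implicit.
Unset Printing Implicit Defensive.

Import Order.TTheory GRing.Theory Num.Theory.
Import numFieldNormedType.Exports.

Local Open Scope classical_set_scope.
Local Open Scope ring_scope.

(* Write [G = grad f x], [v = grad f w] and [e] for the averaged compression
   error of the workers at the shift [w], so that [x' = x - gamma (v + e)].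
   Conditionally on the past, [e] is centered and its n summands are orthogonal,
   hence [E |e|^2 <= omega / n^2 * sum_i |grad f_i w|^2]; a gradient step from [w]
   for each f_i bounds that sum by [2 n Lmax (f w - fstar + Deltastar)], and
   [f w - fstar <= 2 (f x - fstar) + L |w - x|^2].  The Lyapunov function
   [Psi = E (f x - fstar) + L / 2 * E |w - x|^2] therefore satisfies
   [Psi' + gamma / 2 * E |G|^2 <= (1 + 4 A) Psi + 2 A Deltastar] with
   [A = gamma^2 L Lmax omega / n].  The three terms of the stepsize give
   [gamma L <= alpha / 8], [A <= 1 / (2 T)] and
   [2 A Deltastar <= gamma eps / 16], and the bound on T gives
   [Psi 0 <= gamma T eps / 48]; if every [E |G|^2] exceeded eps, Psi would become
   negative within T steps. *)

(** * Euclidean geometry and smooth functions *)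

Definition dot (R : realType) (d : nat) (x y : 'rV[R]_d) : R :=
  \sum_(j < d) x ord0 j * y ord0 j.

Section dot_theory.
Context {R : realType} {d : nat}.
Implicit Types (x y z : 'rV[R]_d) (a : R).

Lemma dotC x y : dot x y = dot y x.
Proof. by apply: eq_bigr => j _; rewrite mulrC. Qed.

Lemma dotDl x y z : dot (x + y) z = dot x z + dot y z.
Proof. by rewrite -big_split; apply: eq_bigr => j _; rewrite mxE mulrDl. Qed.

Lemma dotZl a x y : dot (a *: x) y = a * dot x y.
Proof. by rewrite mulr_sumr; apply: eq_bigr => j _; rewrite mxE mulrA. Qed.

Lemma dotDr x y z : dot z (x + y) = dot z x + dot z y.
Proof. by rewrite dotC dotDl !(dotC _ z). Qed.

Lemma dotZr a x y : dot x (a *: y) = a * dot x y.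
Proof. by rewrite dotC dotZl (dotC y). Qed.

Lemma dotNl x y : dot (- x) y = - dot x y.
Proof. by rewrite -scaleN1r dotZl mulN1r. Qed.

Lemma dotNr x y : dot x (- y) = - dot x y.
Proof. by rewrite dotC dotNl dotC. Qed.

Lemma dot0l x : dot 0 x = 0.
Proof. by rewrite -(scale0r 0) dotZl mul0r. Qed.

Lemma dot_suml (I : Type) (r : seq I) (P : pred I) (F : I -> 'rV[R]_d) y :
  dot (\sum_(i <- r | P i) F i) y = \sum_(i <- r | P i) dot (F i) y.
Proof.
by elim/big_ind2 : _ => [|u a v b <- <-|//]; rewrite ?dot0l ?dotDl.
Qed.

Lemma dot_sumr (I : Type) (r : seq I) (P : pred I) (F : I -> 'rV[R]_d) y :
  dot y (\sum_(i <- r | P i) F i) = \sum_(i <- r | P i) dot y (F i).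
Proof. by rewrite dotC dot_suml; apply: eq_bigr => i _; rewrite dotC. Qed.

Lemma dot_ge0 x : 0 <= dot x x.
Proof. by apply: sumr_ge0 => j _; rewrite -expr2 sqr_ge0. Qed.

Lemma sqr_enorm x : enorm x ^+ 2 = dot x x.
Proof.
rewrite sqr_sqrtr; last by apply: sumr_ge0 => j _; rewrite sqr_ge0.
by apply: eq_bigr => j _; rewrite expr2.
Qed.

Lemma enorm_ge0 x : 0 <= enorm x.
Proof. exact: sqrtr_ge0. Qed.

Lemma enormE x : enorm x = Num.sqrt (dot x x).
Proof. by rewrite -sqr_enorm sqrtr_sqr ger0_norm ?enorm_ge0. Qed.

Lemma enormZ a x : enorm (a *: x) = `|a| * enorm x.
Proof.
by rewrite !enormE dotZl dotZr mulrA -expr2 sqrtrM ?sqr_ge0// sqrtr_sqr.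
Qed.

(** Expand [|a x - y|^2 >= 0] and divide by [a]. *)
Lemma young x y a : 0 < a -> 2 * dot x y <= a * dot x x + a^-1 * dot y y.
Proof.
move=> a0; have := dot_ge0 (a *: x - y).
rewrite !(dotDl, dotDr, dotNl, dotNr, dotZl, dotZr) (dotC y x) => h.
rewrite -(ler_pM2l a0) mulrDr (mulrA a a^-1) divff ?gt_eqF// mul1r.
by lra.
Qed.

(** The instance of Cauchy-Schwarz used in [descent], obtained from [young] with weight [M^-1]. That
    weight degenerates at [M = 0], where [x] vanishes coordinatewise. *)
Lemma dot_le_enorm x y M : 0 <= M -> enorm x <= M * enorm y ->
  dot x y <= M * dot y y.
Proof.
rewrite le_eqVlt => /predU1P[<-|M0] xy.
  have x0 : dot x x <= 0.
    move: xy; rewrite mul0r -sqr_enorm => x0.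
    by rewrite (_ : enorm x = 0) ?expr0n//; apply/eqP; rewrite eq_le x0 enorm_ge0.
  have {}x0 j : x ord0 j = 0.
    have : x ord0 j ^+ 2 <= 0.
      apply: le_trans x0; rewrite /dot (bigD1 j)//= -expr2 lerDl.
      by apply: sumr_ge0 => i _; rewrite -expr2 sqr_ge0.
    by rewrite le_eqVlt ltNge sqr_ge0 orbF sqrf_eq0 => /eqP.
  by rewrite mul0r /dot big1// => j _; rewrite x0 mul0r.
have h : dot x x <= M ^+ 2 * dot y y.
  by rewrite -!sqr_enorm -exprMn ler_sqr ?nnegrE// ?mulr_ge0 ?enorm_ge0// ltW.
have iM : 0 < M^-1 by rewrite invr_gt0.
have := young x y iM; rewrite invrK.
have : M^-1 * dot x x <= M * dot y y.
  by rewrite ler_pdivrMl// mulrA -expr2.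
lra.
Qed.

End dot_theory.

Section smooth_functions.
Context {R : realType} {d : nat}.
Implicit Types (phi : 'rV[R]_d -> R) (x y : 'rV[R]_d).

Lemma derive_dot_grad phi x h : differentiable phi x ->
  'D_h phi x = dot (grad phi x) h.
Proof.
move=> dphi; rewrite deriveE// {1}(row_sum_delta h) linear_sum.
apply: eq_bigr => j _; rewrite linearZ /= mxE deriveE//.
by rewrite mulrC.
Qed.

(** Along the segment, [p] is [phi] minus the first-order term and the quadratic term. By the
    Lipschitz bound on the gradient its derivative is nonpositive, so [p 1 <= p 0]; no integration
    is involved. *)
Lemma descent phi L x y : 0 <= L -> smooth L phi ->
  phi y <= phi x + dot (grad phi x) (y - x) + L / 2 * dot (y - x) (y - x).
Proof.
move=> L0 [dphi lip]; set h := y - x.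
pose g (s : R) := phi (s *: h + x).
pose p (s : R) := g s - (s * dot (grad phi x) h + s ^+ 2 * (L / 2 * dot h h)).
have dg (s : R) : is_derive s (1 : R) g (dot (grad phi (s *: h + x)) h).
  (* The difference quotient of [g] at [s] is that of [phi] in direction [h], so the derivative of
     [g] is a directional derivative. *)
  have shiftE : (fun e : R => e^-1 *: ((g \o shift s) (e *: (1 : R)) - g s)) =
      (fun e : R => e^-1 *: ((phi \o shift (s *: h + x)) (e *: h) - phi (s *: h + x))).
    apply/funext => e /=; congr (_ *: (phi _ - _)).
    by rewrite addrA -scalerDl scaler1.
  apply: DeriveDef.
    by rewrite /derivable shiftE; exact: diff_derivable.
  by rewrite -derive_dot_grad// /derive shiftE.
have dp (s : R) : is_derive s (1 : R) p
   (dot (grad phi (s *: h + x)) h - (dot (grad phi x) h + s * (L * dot h h))).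
  rewrite /p; apply: is_deriveB; apply: is_derive_eq.
  by rewrite scaler0 add0r /=; rewrite /GRing.scale/=; field.
have : p 1 <= p 0.
  apply: (@ler0_derive1_nincr _ p 0 1) => //.
  - move=> s /[!in_itv]/= /andP[s0 s1]; rewrite derive1E.
    rewrite (@derive_val _ _ _ _ _ _ _ (dp s)) opprD addrA -dotNl -dotDl.
    rewrite subr_le0 mulrA; apply: dot_le_enorm; first by rewrite mulr_ge0// ltW.
    apply: le_trans (lip _ _) _; rewrite addrK enormZ mulrA ger0_norm ?(ltW s0)//.
    by rewrite (mulrC L).
  - apply: continuous_subspaceT => s; apply: differentiable_continuous.
    exact/derivable1_diffP.
rewrite /p /g !scale0r scale1r subrK add0r expr1n expr0n/= !mul0r !mul1r addr0.
by rewrite subr0 lerBlDr addrA.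
Qed.

Lemma smooth_le phi L M : L <= M -> smooth L phi -> smooth M phi.
Proof.
move=> LM [dphi lip]; split=> // x y; apply: le_trans (lip x y) _.
by rewrite ler_wpM2r ?enorm_ge0.
Qed.

(* A gradient step of length [1 / M] cannot go below the lower bound [c]. *)
Lemma grad_le_gap phi M c x : 0 <= M -> smooth M phi ->
  (forall y, c <= phi y) -> dot (grad phi x) (grad phi x) <= 2 * M * (phi x - c).
Proof.
move=> M0 sphi cphi; set b := dot _ _.
have pos K : M <= K -> 0 < K -> b <= 2 * K * (phi x - c).
  move=> /smooth_le /(_ sphi) {}sphi K0; set G := grad phi x.
  have := descent x (x - K^-1 *: G) (ltW K0) sphi; rewrite (addrAC x) subrr add0r.
  rewrite !(dotNl, dotNr, dotZl, dotZr) -/G -/b opprK.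
  have := cphi (x - K^-1 *: G); move: (phi (_ - _)) => u cu.
  rewrite (_ : K / 2 * _ = K^-1 * b / 2); last by field; rewrite gt_eqF.
  move=> uphi; rewrite -ler_pdivrMl ?mulr_gt0// invfM -!mulrA.
  by move: (K^-1 * b) uphi => q; lra.
have gap0 : 0 <= phi x - c by rewrite subr_ge0.
(* [M] may be 0, so the step length is [1 / K] with [K] slightly above [M]; the increment costs
   [e * gap / (gap + 1) <= e], where [gap = phi x - c]. *)
apply/ler_addgt0Pr => e e0; pose K := M + e / (2 * (phi x - c + 1)).
have K0 : 0 < e / (2 * (phi x - c + 1)).
  by rewrite divr_gt0// mulr_gt0// ltr_wpDl.
have MK : M <= K by rewrite lerDl ltW.
apply: le_trans (pos K MK _) _; first by rewrite ltr_wpDl.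
rewrite mulrAC mulrDr mulrAC lerD2l mulrA ler_pdivrMr.
  by move: e0 gap0; move: (phi x - c) => q; nra.
by rewrite mulr_gt0// ltr_wpDl.
Qed.

(** In [descent], the cross term is split by [young] with weight [L^-1], and [grad_le_gap] turns
    [L^-1 * |grad phi x|^2] into twice the gap. *)
Lemma gap_shift phi L c x y : 0 < L -> smooth L phi ->
  (forall y, c <= phi y) ->
  phi y - c <= 2 * (phi x - c) + L * dot (y - x) (y - x).
Proof.
move=> L0 sphi cphi; have := descent x y (ltW L0) sphi.
have := grad_le_gap x (ltW L0) sphi cphi; have iL : 0 < L^-1 by rewrite invr_gt0.
have := young (grad phi x) (y - x) iL; rewrite invrK.
set b := dot (grad _ _) (grad _ _); set u := dot _ (y - x).
set v := dot _ _ => h1 h2 h3.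
have : L^-1 * b <= 2 * (phi x - c) by rewrite ler_pdivrMl// mulrCA mulrA.
by lra.
Qed.

Lemma grad_average n (f : 'I_n -> 'rV[R]_d -> R) x :
  (forall i y, differentiable (f i) y) ->
  grad (average f) x = n%:R^-1 *: \sum_(i < n) grad (f i) x.
Proof.
move=> df; apply/rowP => j; rewrite !mxE summxE.
have -> : average f = n%:R^-1 *: \sum_(i < n) f i.
  by apply/funext => y; rewrite /average fct_sumE.
rewrite deriveZ; last by apply: derivable_sum => i; exact: diff_derivable.
rewrite derive_sum; last by move=> i; exact: diff_derivable.
by congr (_ *: _); apply: eq_bigr => i _; rewrite mxE.
Qed.

(** [grad_le_gap] summed over the workers. The number [c] cancels; it is inserted so that, for
    [c = fstar], the second bracket is [Deltastar]. *)
Lemma sum_grad_le_gap n (f : 'I_n -> 'rV[R]_d -> R) M c (ci : 'I_n -> R) x :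
  (0 < n)%N -> 0 <= M -> (forall i, smooth M (f i)) ->
  (forall i y, ci i <= f i y) ->
  \sum_(i < n) dot (grad (f i) x) (grad (f i) x) <=
  2 * M * n%:R * (average f x - c + (c - n%:R^-1 * \sum_(i < n) ci i)).
Proof.
move=> n0 M0 sf cf; rewrite addrA subrK.
have nR : n%:R != 0 :> R by rewrite pnatr_eq0 -lt0n.
rewrite /average -mulrBr -mulrA mulVKf// -sumrB mulr_sumr.
by apply: ler_sum => i _; exact: grad_le_gap.
Qed.

End smooth_functions.

(** * Borel measurability of vector-valued functions *)

Section borel_vectors.
Context {R : realType} {d : nat}.

(** Coordinates are continuous, which gives one direction. Conversely, an open set is a countable
    union of boxes with rational centres, and the preimage of a box is a finite intersection of
    coordinate preimages. *)
Lemma measurable_rVP dT (T : measurableType dT) (V : T -> 'rV[R]_d) :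
  measurable_fun setT (V : T -> borel_rV R d) <->
  forall j, measurable_fun setT (fun t => V t ord0 j).
Proof.
split=> [mV j|mV].
  apply: (@measurableT_comp _ _ _ _ _ _ (fun v : borel_rV R d => v ord0 j)) mV.
  apply: (measurability _ (RGenOpens.measurableE R)) => _ [_ [a [b ->]] <-].
  rewrite setTI; apply: sub_sigma_algebra.
  by apply: open_comp => [v _|//]; exact: coord_continuous.
apply: (@measurability _ _ _ (borel_rV R d) setT V (@open 'rV[R]_d)) => //= _ [A oA <-].
rewrite setTI.
(* Open sup-norm box with centre [p.1] and radius [1 / (p.2 + 1)]. *)
pose B (p : 'rV[rat]_d * nat) :=
  [set y : 'rV[R]_d | forall j, `|ratr (p.1 ord0 j) - y ord0 j| < p.2.+1%:R^-1].
have mB p : measurable (V @^-1` B p).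
  rewrite (_ : V @^-1` B p = \bigcap_(j in [set: 'I_d]) ((fun t => V t ord0 j) @^-1`
      ball (ratr (p.1 ord0 j) : R) p.2.+1%:R^-1)); last first.
    by rewrite -ball_normE; apply/seteqP; split=> [t Bt j _|t Bt j]; exact: Bt.
  apply: fin_bigcap_measurable => // j _; rewrite -[X in measurable X]setTI.
  by apply: mV => //; exact: measurable_ball.
rewrite (_ : V @^-1` A = \bigcup_p
    (if `[< B p `<=` A >] then V @^-1` B p else set0)).
  apply: countable_bigcupT_measurable => // p; case: ifP => _ //; exact: measurable0.
apply/seteqP; split=> [t At|t [p _]]; last by case: asboolP => // BA; exact: BA.
have /nbhs_ballP[e /= e0 eA] : nbhs (V t) A by exact: open_nbhs_nbhs.
(* A box containing [V t] stays within two radii of it, so twice the radius must be below [e]. *)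
have [m me] : exists m : nat, m.+1%:R^-1 + m.+1%:R^-1 < e.
  have e2 : 0 < e / 2 by rewrite divr_gt0.
  have [m _ /(_ m (leqnn _)) me] := near_infty_natSinv_lt (PosNum e2).
  by exists m; rewrite (splitr e) ltrD.
have qP j : exists q : rat, `|ratr q - V t ord0 j| < m.+1%:R^-1.
  have [|q] := @rat_in_itvoo R (V t ord0 j) (V t ord0 j + m.+1%:R^-1).
    by rewrite ltrDl.
  rewrite in_itv/= => /andP[q1 q2]; exists q.
  by rewrite gtr0_norm ?subr_gt0// ltrBlDl.
pose p : 'rV[rat]_d * nat := (\row_j projT1 (cid (qP j)), m).
have pP j : `|ratr (p.1 ord0 j) - V t ord0 j| < m.+1%:R^-1.
  by rewrite mxE; case: cid.
exists p => //; rewrite ifT//; apply/asboolP => y By; apply: eA.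
split=> // i j; rewrite (ord1 i) -ball_normE/=.
apply: le_lt_trans me; rewrite -(subrKA (ratr (p.1 ord0 j))).
apply: le_trans (ler_normD _ _) _; apply: lerD; apply: ltW; last exact: By.
by rewrite distrC; exact: pP.
Qed.

Lemma continuous_measurable_rV (phi : 'rV[R]_d -> R) : continuous phi ->
  measurable_fun setT (phi : borel_rV R d -> R).
Proof.
move=> cphi.
apply: (measurability _ (RGenOpens.measurableE R)) => _ [_ [a [b ->]] <-].
rewrite setTI; apply: sub_sigma_algebra.
by apply: open_comp => [v _|//]; exact: cphi.
Qed.

Lemma coord_le_enorm (x : 'rV[R]_d) j : `|x ord0 j| <= enorm x.
Proof.
rewrite -(@ler_pXn2r _ 2) ?nnegrE ?enorm_ge0// sqr_enorm real_normK ?num_real//.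
rewrite /dot (bigD1 j)//= -expr2 lerDl.
by apply: sumr_ge0 => k _; rewrite -expr2 sqr_ge0.
Qed.

Lemma enorm_le_norm (x : 'rV[R]_d) : enorm x <= Num.sqrt d%:R * `|x|.
Proof.
rewrite -(@ler_pXn2r _ 2) ?nnegrE ?enorm_ge0 ?mulr_ge0 ?sqrtr_ge0//.
rewrite sqr_enorm exprMn sqr_sqrtr// mulr_natl -[X in _ *+ X]card_ord -sumr_const.
apply: ler_sum => k _; rewrite -expr2 -real_normK ?num_real// ler_sqr ?nnegrE//.
rewrite {2}/Num.norm/= mx_normrE.
by apply: (le_bigmax _ (fun ij => `|x ij.1 ij.2|) (ord0, k)).
Qed.

(** A Lipschitz gradient is continuous; [enorm_le_norm] passes from the Euclidean norm to the sup
    norm that defines the topology. *)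
Lemma smooth_measurable (L : R) (phi : 'rV[R]_d -> R) : smooth L phi ->
  measurable_fun setT (phi : borel_rV R d -> R) /\
  measurable_fun setT (grad phi : borel_rV R d -> borel_rV R d).
Proof.
move=> [dphi lip]; split.
  by apply: continuous_measurable_rV => v; exact: differentiable_continuous.
apply/measurable_rVP => j; apply: continuous_measurable_rV => v.
apply/(@cvgrPdist_le _ _ _ (nbhs v) (nbhs_filter v)) => e e0.
(* [smooth] fixes no sign for [L], hence [|L|]; adding 1 keeps the divisor positive when [L] or [d]
   is zero. *)
have L0 : 0 < `|L| * Num.sqrt d%:R + 1 by rewrite ltr_wpDl// mulr_ge0.
apply/nbhs_ballP; exists (e / (`|L| * Num.sqrt d%:R + 1)) => /=.
  by rewrite divr_gt0.
move=> u; rewrite -ball_normE/= ltr_pdivlMr// => /ltW vu.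
have -> : grad phi v ord0 j - grad phi u ord0 j =
    (grad phi v - grad phi u) ord0 j by rewrite !mxE.
apply: le_trans (coord_le_enorm _ _) _; apply: le_trans (lip _ _) _.
apply: le_trans vu; apply: (@le_trans _ _ (`|L| * (Num.sqrt d%:R * `|v - u|))).
  have := enorm_le_norm (v - u); have := enorm_ge0 (v - u).
  by move=> ? ?; apply: le_trans (ler_wpM2r _ (ler_norm L)) _ => //; exact: ler_wpM2l.
by rewrite mulrA mulrC ler_wpM2l// lerDl.
Qed.

End borel_vectors.

Section measurable_vectors.
Context {R : realType} {d : nat} {dT : measure_display} {T : measurableType dT}.
Implicit Types U V : T -> borel_rV R d.

Lemma measurable_dot U V : measurable_fun setT U -> measurable_fun setT V ->
  measurable_fun setT (fun t => dot (U t) (V t)).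
Proof.
move=> /measurable_rVP mU /measurable_rVP mV.
by apply: measurable_sum => j; exact: measurable_funM.
Qed.

Lemma measurable_rVD U V : measurable_fun setT U -> measurable_fun setT V ->
  measurable_fun setT (fun t => (U t : 'rV[R]_d) + V t : borel_rV R d).
Proof.
move=> /measurable_rVP mU /measurable_rVP mV; apply/measurable_rVP => j.
by under eq_fun do rewrite mxE; exact: measurable_funD.
Qed.

Lemma measurable_rVZ (a : R) V : measurable_fun setT V ->
  measurable_fun setT (fun t => a *: (V t : 'rV[R]_d) : borel_rV R d).
Proof.
move=> /measurable_rVP mV; apply/measurable_rVP => j.
by under eq_fun do rewrite mxE; exact: measurable_funM.
Qed.

Lemma measurable_rVB U V : measurable_fun setT U -> measurable_fun setT V ->
  measurable_fun setT (fun t => (U t : 'rV[R]_d) - V t : borel_rV R d).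
Proof.
move=> mU /(measurable_rVZ (-1)) mV; have := measurable_rVD mU mV.
by under eq_fun do rewrite scaleN1r.
Qed.

Lemma measurable_rV_sum n (V : 'I_n -> T -> borel_rV R d) :
  (forall i, measurable_fun setT (V i)) ->
  measurable_fun setT (fun t => \sum_(i < n) (V i t : 'rV[R]_d) : borel_rV R d).
Proof.
move=> mV; apply/measurable_rVP => j; under eq_fun do rewrite summxE.
by apply: measurable_sum => i; have /measurable_rVP := mV i; exact.
Qed.

End measurable_vectors.

(** * Integrability and integrals of real-valued functions *)

Section real_integrable.
Context {R : realType} {dT : measure_display} {T : measurableType dT}
  (mu : {measure set T -> \bar R}).
Implicit Types X Y : T -> R.
Local Notation integrable X := (mu.-integrable setT (EFin \o X)).

Lemma integrable_le X Y : measurable_fun setT X -> (forall t, `|X t| <= Y t) ->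
  integrable Y -> integrable X.
Proof.
move=> mX XY; apply: le_integrable => //; first exact/measurable_EFinP.
by move=> t _ /=; rewrite lee_fin; exact: le_trans (XY t) (ler_norm _).
Qed.

Lemma integrable_EFinD X Y : integrable X -> integrable Y ->
  integrable (fun t => X t + Y t).
Proof. by move=> iX iY; exact: (integrableD measurableT iX iY). Qed.

Lemma integrable_EFinZ k X : integrable X -> integrable (fun t => k * X t).
Proof. by move=> iX; exact: (integrableZl measurableT k iX). Qed.

Lemma integrable_EFin_sum (I : Type) (s : seq I) (X : I -> T -> R) :
  (forall i, integrable (X i)) -> integrable (fun t => \sum_(i <- s) X i t).
Proof.
move=> iX.
have := integrable_sum measurableT s (fun i (_ : xpredT i) => iX i).
by apply: eq_integrable => // t _; rewrite /= sumEFin.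
Qed.

Lemma Rintegral_sum (I : Type) (s : seq I) (X : I -> T -> R) :
  (forall i, integrable (X i)) ->
  \int[mu]_t (\sum_(i <- s) X i t) = \sum_(i <- s) \int[mu]_t X i t.
Proof.
move=> iX; elim: s => [|i s IH].
  under eq_Rintegral do rewrite big_nil.
  by rewrite big_nil /Rintegral integral0.
under eq_Rintegral do rewrite big_cons.
by rewrite RintegralD// ?IH ?big_cons//; exact: integrable_EFin_sum.
Qed.

End real_integrable.

(** * Independence and compression errors *)

(* [F k] collects the events decided by the k-th source of randomness; with
   [J] finite, [g_sigma_algebraType (sources F J)] is the sample space equipped
   with the events decided by the sources in [J] only. *)
Definition sources (Omega I : Type) (F : I -> set (set Omega)) (J : set I) :
    set (set Omega) :=
  \bigcup_(k in J) F k.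

Section independence.
Context {R : realType} {dO : measure_display} {Omega : measurableType dO}
  {P : probability Omega R} {I : finType} {F : I -> set (set Omega)}.
Hypothesis F_measurable : forall k, F k `<=` measurable.
Hypothesis FT : forall k, F k setT.
Hypothesis FI : forall k, setI_closed (F k).
Hypothesis F_indep : mutually_independent P F.

Local Notation past J := (g_sigma_algebraType (sources F [set` J])).

Lemma sources_measurable (J : {set I}) (A : set Omega) :
  measurable (A : set (past J)) -> measurable A.
Proof.
apply: smallest_sub; first exact: sigma_algebra_measurable.
by move=> B [k _]; exact: F_measurable.
Qed.

(* The finite intersections of events of the sources in [J] form a pi-system. *)
Lemma independent_past (J : {set I}) (k : I) (A B : set Omega) :
  k \notin J -> measurable (A : set (past J)) -> F k B ->
  P (A `&` B) = (P A * P B)%E.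
Proof.
move=> kJ mA FB; have mB := F_measurable FB.
pose G := [set \bigcap_(i in [set` J]) C i | C in [set C | forall i, F i (C i)]].
have GI : setI_closed G.
  move=> _ _ [C FC <-] [D FD <-]; exists (fun i => C i `&` D i).
    by move=> i; apply: FI.
  by rewrite bigcapI.
have Gm : G `<=` measurable.
  move=> _ [C FC <-]; apply: fin_bigcap_measurable => // i _.
  exact: F_measurable (FC i).
have GT : G setT.
  by exists (fun=> setT) => //; apply/seteqP; split.
have PB0 : 0 <= fine (P B) by rewrite fine_ge0.
(* [mrestr P mB] maps [C] to [P (C & B)] and [m2] maps it to [P B * P C]. Measures that agree on the
   pi-system [G] agree on the sigma-algebra it generates, which contains [A]. *)
pose m2 := mscale (NngNum PB0) P.
have sG : <<s G >> A.
  move: mA; apply: smallest_sub; first exact: smallest_sigma_algebra.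
  move=> C [i iJ FiC]; apply: sub_sigma_algebra.
  (* An event of a single source belongs to [G] once padded with [setT] at the other sources. *)
  exists (fun j => if j == i then C else setT).
    by move=> j /=; case: eqVneq => [->|].
  apply/seteqP; split=> [t /(_ i iJ)|t Ct j _]; first by rewrite eqxx.
  by case: eqP.
have m2E C : m2 C = (P B * P C)%E by rewrite /m2 /mscale/= fineK ?fin_num_measure.
suff : mrestr P mB A = m2 A by rewrite m2E muleC.
apply: (@g_sigma_algebra_measure_unique _ R Omega G Gm (fun=> setT) (fun=> GT) _
  [the measure _ _ of mrestr P mB] [the measure _ _ of m2]) => //.
- by rewrite bigcup_const//; exists 0%N.
- move=> _ [C FC <-]; rewrite -[RHS]/(m2 _) m2E -[LHS]/(P (_ `&` B)).
  (* Independence is applied to [k |: J] with [B] placed at [k]; since [k] is outside [J], the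
     product factors and [D] agrees with [C] on [J]. *)
  pose D i := if i == k then B else C i.
  have FD i : F i (D i) by rewrite /D; case: eqVneq => [->|].
  have := @F_indep (k |: J) D (fun i _ => FD i).
  rewrite big_setU1//= {1 2}/D eqxx => h.
  have -> : \bigcap_(i in [set` J]) C i `&` B = \bigcap_(i in [set` k |: J]) D i.
    apply/seteqP; split=> [t [Ct Bt] i|t Dt].
      rewrite /= !inE /D; case: eqVneq => [-> //|_ /= iJ]; exact: Ct.
    split=> [i /= iJ|]; last first.
      by have := Dt k; rewrite /= setU11 /D eqxx; apply.
    have := Dt i; rewrite /= !inE iJ orbT /D => /(_ isT).
    by case: eqVneq iJ kJ => // -> ->.
  rewrite h F_indep//; congr (_ * _)%E; apply: eq_bigr => i iJ.
  by rewrite /D; case: eqVneq iJ kJ => // -> ->.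
- move=> _; rewrite -[X in (X < _)%E]/(P (_ `&` B)) setTI.
  exact: le_lt_trans (probability_le1 _ _) (ltry _).
Qed.

Lemma sources_sub (J K : {set I}) (A : set Omega) : J \subset K ->
  measurable (A : set (past J)) -> measurable (A : set (past K)).
Proof.
move=> /fintype.subsetP JK; apply: smallest_sub; first exact: smallest_sigma_algebra.
by move=> B [k kJ FB]; apply: sub_sigma_algebra; exists k => //=; exact: JK.
Qed.

(** [independent_past] in the form consumed by the Fubini arguments below: a fresh seed [X] of law
    [mu] against a variable [Y] decided by the past. *)
Lemma past_independent dS dE (S : measurableType dS) (E : measurableType dE)
    (mu : probability S R) (X : Omega -> S) (Y : Omega -> E)
    (J : {set I}) (k : I) : k \notin J ->
  (forall A, measurable A -> F k (X @^-1` A)) ->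
  (forall A, measurable A -> P (X @^-1` A) = mu A) ->
  measurable_fun setT (Y : past J -> E) ->
  forall A B, measurable A -> measurable B ->
  P (X @^-1` A `&` Y @^-1` B) = (mu A * P (Y @^-1` B))%E.
Proof.
move=> kJ FX Xmu mY A B mA mB; rewrite setIC (independent_past kJ _ (FX A mA)).
  by rewrite Xmu// muleC.
by rewrite -[Y @^-1` B]setTI; exact: mY.
Qed.

End independence.

(** * Integrating out an independent seed *)

Section independent_integral.
Context {R : realType} {dO dS dE : measure_display} {Omega : measurableType dO}
  {S : measurableType dS} {E : measurableType dE}.
Variables (P : probability Omega R) (mu : probability S R).
Variables (X : Omega -> S) (Y : Omega -> E).
Hypothesis mX : measurable_fun setT X.
Hypothesis mY : measurable_fun setT Y.
Hypothesis XY_indep : forall A B, measurable A -> measurable B ->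
  P (X @^-1` A `&` Y @^-1` B) = (mu A * P (Y @^-1` B))%E.

Let Z w := (X w, Y w).
Let Ym : {mfun Omega >-> E} := HB.pack Y (isMeasurableFun.Build _ _ _ _ _ mY).

Let mZ : measurable_fun setT Z.
Proof. exact: measurable_fun_pair. Qed.

(** A product measure is determined by its values on measurable rectangles, which [XY_indep]
    provides. *)
Let joint_law A : measurable A -> pushforward P Z A = (mu \x distribution P Ym)%E A.
Proof.
move=> mA; apply/esym.
apply: (@product_measure_unique _ _ _ _ _ mu (distribution P Ym)
  [the measure _ _ of pushforward P Z]) => //.
Qed.

Local Open Scope ereal_scope.

(** Tonelli for the joint law. Integrating over the seed with [Y] frozen stands in for a conditional
    expectation given the past. *)
Lemma ge0_integral_independent (h : S * E -> \bar R) :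
  measurable_fun setT h -> (forall z, 0 <= h z) ->
  \int[P]_w h (X w, Y w) = \int[P]_w \int[mu]_s h (s, Y w).
Proof.
move=> mh h0.
rewrite -[LHS]/(\int[P]_(w in Z @^-1` setT) (h \o Z) w).
rewrite -(ge0_integral_pushforward mZ P measurableT mh); last by move=> ? _.
rewrite (eq_measure_integral (mu \x distribution P Ym)); last first.
  by move=> A mA _; exact: joint_law.
rewrite fubini_tonelli2// (ge0_integral_pushforward mY)//.
  exact: measurable_fun_fubini_tonelli_G.
by move=> y _; exact: integral_ge0.
Qed.

(** The signed counterpart: Fubini applies because integrability on [Omega] is transported to the
    product measure. *)
Lemma integral_independent_eq0 (h : S * E -> \bar R) :
  measurable_fun setT h -> P.-integrable setT (fun w => h (X w, Y w)) ->
  (forall y, \int[mu]_s h (s, y) = 0) ->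
  \int[P]_w h (X w, Y w) = 0.
Proof.
move=> mh ih h0.
have ipush : (pushforward P Z).-integrable setT h.
  exact: integrable_pushforward.
rewrite -[LHS]/(\int[P]_(w in Z @^-1` setT) (h \o Z) w).
rewrite -(integral_pushforward mZ)//.
rewrite (eq_measure_integral (mu \x distribution P Ym)); last first.
  by move=> A mA _; exact: joint_law.
rewrite -integral21_prod_meas1; last first.
  apply/integrableP; split => //.
  rewrite (eq_measure_integral (pushforward P Z)); last first.
    by move=> A mA _; exact/esym/joint_law.
  by have /integrableP[] := ipush.
by apply: integral0_eq => y _; exact: h0.
Qed.

End independent_integral.

(** * First and second moments of compression errors *)

Section compression_errors.
Context {R : realType} {d : nat} {dO : measure_display} {Omega : measurableType dO}
  {P : probability Omega R} (C : stoch_map R d) (xi : Omega -> seed C)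
  (U V : Omega -> borel_rV R d).
Hypothesis mxi : measurable_fun setT xi.
Hypothesis mV : measurable_fun setT V.

Let err (p : seed C * borel_rV R d) : 'rV[R]_d := act C p.1 p.2 - p.2.

Let merr : measurable_fun setT (err : _ -> borel_rV R d).
Proof.
by apply: measurable_rVB; [exact: act_measurable|exact: measurable_snd].
Qed.

(** With [V] frozen, the inner integral is the compressor bound at a point. A general [K] serves
    both classes, with [K = omega] and [K = 1 - alpha]; extended reals allow its use before any
    integrability is known. *)
Lemma integral_error_le K :
  (forall x : 'rV[R]_d, ('E_(law C)[(fun s => (enorm (act C s x - x) ^+ 2)%R)]
       <= (K * enorm x ^+ 2)%R%:E)%E) -> 0 <= K ->
  (forall A B, measurable A -> measurable B ->
    P (xi @^-1` A `&` V @^-1` B) = (law C A * P (V @^-1` B))%E) ->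
  (\int[P]_w (dot (act C (xi w) (V w) - V w) (act C (xi w) (V w) - V w))%:E <=
   K%:E * \int[P]_w (dot (V w) (V w))%:E)%E.
Proof.
move=> CK K0 indep.
pose h p := (dot (err p) (err p))%:E.
have mh : measurable_fun setT h by exact/measurable_EFinP/measurable_dot.
have h0 p : (0 <= h p)%E by rewrite lee_fin dot_ge0.
rewrite (ge0_integral_independent mxi mV indep mh h0).
rewrite -ge0_integralZl//; first last.
- by move=> w _; rewrite lee_fin dot_ge0.
- by apply/measurable_EFinP; exact: measurable_dot.
apply: ge0_le_integral => //.
- by move=> w _; exact: integral_ge0.
- have := @measurable_fun_fubini_tonelli_G _ _ _ _ _ (law C) h mh h0.
  by move=> /measurableT_comp; apply.
- apply: measurable_funeM; apply/measurable_EFinP; exact: measurable_dot.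
move=> w _; rewrite -EFinM -sqr_enorm; apply: le_trans (CK (V w)).
by rewrite unlock; under [leRHS]eq_integral do rewrite sqr_enorm.
Qed.

Hypothesis mU : measurable_fun setT U.

(** With [U] and [V] frozen the error has mean zero, by unbiasedness. The seed must be independent
    of the pair, not just of each component. *)
Lemma integral_dot_error_eq0 omega : unbiased_compressor omega C ->
  (forall A B, measurable A -> measurable B ->
    P (xi @^-1` A `&` (fun w => (U w, V w)) @^-1` B) =
    (law C A * P ((fun w => (U w, V w)) @^-1` B))%E) ->
  P.-integrable setT (fun w => (dot (U w) (act C (xi w) (V w) - V w))%:E) ->
  (\int[P]_w (dot (U w) (act C (xi w) (V w) - V w))%:E = 0)%E.
Proof.
move=> CU indep iUV.
pose h (p : seed C * (borel_rV R d * borel_rV R d)) :=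
  (dot (p.2.1 : 'rV[R]_d) (err (p.1, p.2.2)))%:E.
have m2 : measurable_fun setT
    (fun p : seed C * (borel_rV R d * borel_rV R d) => (p.1, p.2.2)).
  apply: measurable_fun_pair => //; exact: measurableT_comp.
have mh : measurable_fun setT h.
  apply/measurable_EFinP/measurable_dot; first exact: measurableT_comp.
  exact: measurableT_comp m2.
apply: (integral_independent_eq0 mxi (measurable_fun_pair mU mV) indep mh iUV).
move=> [u v]; rewrite /h/=.
have merrv : measurable_fun setT (fun s => err (s, v) : borel_rV R d).
  exact: measurableT_comp merr (pair2_measurable v).
have merrj j : measurable_fun setT (fun s => err (s, v) ord0 j).
  by have /measurable_rVP := merrv; exact.
have ierr : (law C).-integrable setT (EFin \o (fun s => dot (err (s, v)) (err (s, v)))).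
  apply/integrableP; split; first exact/measurable_EFinP/measurable_dot.
  apply: le_lt_trans (ltry (omega * enorm v ^+ 2)).
  apply: le_trans (CU v).2; rewrite unlock.
  by under eq_integral do rewrite /= ger0_norm ?dot_ge0// -sqr_enorm.
(* The bound [|e_j| <= 1 + |e|^2] derives integrability of the coordinates from the second moment,
   so that the identity [E[C(v)] = v] can be split additively. *)
have ierrj j : (law C).-integrable setT (EFin \o (fun s => err (s, v) ord0 j)).
  apply: (@integrable_le _ _ _ _ _ (fun s => 1 + dot (err (s, v)) (err (s, v)))) => //.
    move=> s; have := coord_le_enorm (err (s, v)) j; rewrite -sqr_enorm.
    by move: (enorm _) => e; nra.
  by apply: integrable_EFinD => //; exact: finite_measure_integrable_cst.
have e0 j : (\int[law C]_s (err (s, v) ord0 j)%:E = 0)%E.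
  have icst : (law C).-integrable setT (EFin \o (fun=> v ord0 j)).
    exact: finite_measure_integrable_cst.
  have := (CU v).1 j; rewrite unlock.
  have -> : (fun s => (act C s v ord0 j)%:E) =
      (fun s => (err (s, v) ord0 j)%:E + (v ord0 j)%:E)%E.
    by apply/funext => s; rewrite -EFinD !mxE subrK.
  have intv : (\int[law C]__ (v ord0 j)%:E = (v ord0 j)%:E)%E.
    have := expectation_cst (law C) (v ord0 j); by rewrite unlock.
  have fin := integrable_fin_num measurableT (ierrj j).
  rewrite (integralD measurableT (ierrj j) icst) intv -(fineK fin) -EFinD => -[/eqP].
  by rewrite -subr_eq0 addrK => /eqP ->.
rewrite /dot; under eq_integral do rewrite -sumEFin.
have iuerr j : (law C).-integrable setT
    (fun s => ((u : 'rV[R]_d) ord0 j * err (s, v) ord0 j)%:E).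
  exact: integrable_EFinZ.
rewrite (integral_sum measurableT iuerr) big1// => j _.
under eq_integral do rewrite EFinM.
by rewrite (integralZl measurableT (ierrj j)) e0 mule0.
Qed.

End compression_errors.

(** * Square-integrable random vectors *)

Section square_integrable.
Context {R : realType} {d : nat} {dO : measure_display} {Omega : measurableType dO}
  (P : probability Omega R).
Implicit Types (U V : Omega -> borel_rV R d) (X Y : Omega -> R).
Local Notation integrable X := (P.-integrable setT (EFin \o X)).

Definition square_integrable U :=
  measurable_fun setT U /\ integrable (fun w => dot (U w) (U w)).

Lemma square_integrable_le U X : measurable_fun setT U ->
  (forall w, dot (U w) (U w) <= X w) -> integrable X -> square_integrable U.
Proof.
move=> mU UX iX; split=> //; apply: integrable_le iX; first exact: measurable_dot.
by move=> w; rewrite ger0_norm ?dot_ge0.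
Qed.

Lemma square_integrableZ a U : square_integrable U ->
  square_integrable (fun w => a *: (U w : 'rV[R]_d)).
Proof.
move=> [mU iU]; apply: (square_integrable_le (X := fun w => a ^+ 2 * dot (U w) (U w))).
- exact: measurable_rVZ.
- by move=> w; rewrite dotZl dotZr mulrA.
- exact: integrable_EFinZ.
Qed.

Lemma square_integrableD U V : square_integrable U -> square_integrable V ->
  square_integrable (fun w => (U w : 'rV[R]_d) + V w).
Proof.
move=> [mU iU] [mV iV]; apply: (square_integrable_le
  (X := fun w => 2 * (dot (U w) (U w) + dot (V w) (V w)))).
- exact: measurable_rVD.
- move=> w; have := young (U w) (V w) ltr01; rewrite invr1.
  by rewrite !(dotDl, dotDr) (dotC (V w) (U w)); lra.
- by apply: integrable_EFinZ; exact: integrable_EFinD.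
Qed.

Lemma square_integrableB U V : square_integrable U -> square_integrable V ->
  square_integrable (fun w => (U w : 'rV[R]_d) - V w).
Proof.
move=> sU /(square_integrableZ (-1)) sV; have := square_integrableD sU sV.
by under eq_fun do rewrite scaleN1r.
Qed.

Lemma square_integrable_sum m (U : 'I_m -> Omega -> borel_rV R d) :
  (forall i, square_integrable (U i)) ->
  square_integrable (fun w => \sum_(i < m) (U i w : 'rV[R]_d)).
Proof.
elim: m => [|m IH] in U * => sU.
  apply: (square_integrable_le (X := fun=> 0)).
  - under eq_fun do rewrite big_ord0; exact: measurable_cst.
  - by move=> w; rewrite big_ord0 dot0l.
  - exact: integrable0.
under eq_fun do rewrite big_ord_recr; apply: square_integrableD => //.
exact: IH.
Qed.

Lemma integrable_dot U V : square_integrable U -> square_integrable V ->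
  integrable (fun w => dot (U w) (V w)).
Proof.
move=> [mU iU] [mV iV].
apply: (integrable_le (Y := fun w => dot (U w) (U w) + dot (V w) (V w))).
- exact: measurable_dot.
- move=> w; have := young (U w) (V w) ltr01.
  have := young (U w) (- V w : 'rV[R]_d) ltr01.
  rewrite !(dotNl, dotNr) invr1 opprK; have := dot_ge0 (U w); have := dot_ge0 (V w).
  by rewrite ler_norml; move: (dot _ _) (dot _ _) (dot _ _) => a b c; lra.
- exact: integrable_EFinD.
Qed.

Lemma EFin_Rintegral X : integrable X ->
  (\int[P]_w (X w)%:E)%E = (\int[P]_w X w)%:E.
Proof.
by move=> iX; rewrite /Rintegral fineK// (integrable_fin_num measurableT iX).
Qed.

Lemma RintegralTcst (r : R) : \int[P]__ r = r.
Proof.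
by have := expectation_cst P r; rewrite unlock /Rintegral => ->.
Qed.

Lemma integrable_EFin_cst (r : R) : integrable (fun=> r).
Proof. exact: finite_measure_integrable_cst. Qed.

End square_integrable.

(** * The Lyapunov function along the iterates *)

Section one_step.
Context {R : realType} {d : nat}.
Implicit Types x w e : 'rV[R]_d.

(** The pathwise step, before any expectation. The terms linear in [e] are gathered in one dot
    product whose other factor depends only on [x] and [w], so that they vanish in expectation. *)
Lemma lyapunov_step (f : 'rV[R]_d -> R) L alpha gamma x w e :
  smooth L f -> 0 < L -> 0 < alpha -> alpha <= 1 -> 0 < gamma ->
  gamma * L <= alpha / 8 ->
  let v := grad f w in
  let x' := x - gamma *: (v + e) in
  f x' + L / 2 * ((1 - alpha) * dot (x' - w) (x' - w)) +
    gamma / 2 * dot (grad f x) (grad f x) <=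
  f x + L / 2 * dot (w - x) (w - x) + L * gamma ^+ 2 * dot e e +
  dot ((L * gamma ^+ 2) *: v - gamma *: grad f x -
         ((1 - alpha) * L * gamma) *: (x - w - gamma *: v)) e.
Proof.
move=> sf L0 a0 a1 g0 gL /=.
set v := grad f w; set x' := x - gamma *: _; set G := grad f x.
have := descent x x' (ltW L0) sf; rewrite /x' (addrAC x) subrr add0r -/G.
(* Polarisation, [- 2 dot G v = |G - v|^2 - |G|^2 - |v|^2], produces the [gamma / 2 * |G|^2] of the
   conclusion and a spare [- gamma / 2 * |v|^2]; smoothness controls [|G - v|^2]. *)
have lip : dot (G - v) (G - v) <= L ^+ 2 * dot (w - x) (w - x).
  have := sf.2 x w; rewrite -/G -/v => lip.
  rewrite -!sqr_enorm -exprMn ler_sqr ?nnegrE ?mulr_ge0 ?enorm_ge0 ?(ltW L0)//.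
  by rewrite -[w - x]opprB -[- (x - w)]scaleN1r enormZ normrN1 mul1r.
have ha : 0 < alpha / 2 by rewrite divr_gt0.
have := young (x - w) (- gamma *: v) ha; move: lip.
rewrite -[w - x]opprB (_ : x - gamma *: (v + e) - w =
  (x - w) - gamma *: (v + e)); last by rewrite addrAC.
move: (x - w) => r.
rewrite !(dotNl, dotNr, dotDl, dotDr, dotZl, dotZr) !opprK.
have := dot_ge0 r; have := dot_ge0 v; have := dot_ge0 e.
rewrite (dotC v G) (dotC e v) (dotC v r) (dotC e r).
move: (f _) (f x) (dot G G) (dot G v) (dot v v) (dot r r) (dot r v) (dot e e)
  (dot G e) (dot v e) (dot r e) => fx' fx a b q p s ee Ge ve re ee0 q0 p0.
rewrite invf_div => lip you desc.
have ab : alpha * alpha^-1 = 1 by rewrite divff ?gt_eqF.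
have b0 : 0 < alpha^-1 by rewrite invr_gt0.
move: alpha^-1 ab b0 you => b' ab b0 you.
have gg0 : 0 <= gamma ^+ 2 * q by rewrite mulr_ge0 ?sqr_ge0.
have gq0 : 0 <= gamma * q by rewrite mulr_ge0// ltW.
have aLp0 : 0 <= alpha * (L * p) by rewrite !mulr_ge0// ltW.
have aLee0 : 0 <= alpha * (L * (gamma ^+ 2 * ee)).
  by rewrite !mulr_ge0 ?sqr_ge0// ltW.
have gLb : gamma * L * b' <= 1 / 8.
  apply: le_trans (ler_wpM2r (ltW b0) gL) _; lra.
(* The Young weight [alpha / 2] gives [(1 - alpha) * (1 + alpha / 2) <= 1 - alpha / 2], which leaves
   half of the contraction; the price is the factor [2 / alpha] on [gamma^2 * |v|^2]. *)
have hX : (1 - alpha) * (p - 2 * (gamma * s) + gamma ^+ 2 * q) <=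
    (1 - alpha / 2) * p + 2 * b' * (gamma ^+ 2 * q).
  apply: (@le_trans _ _ ((1 - alpha) *
      ((1 + alpha / 2) * p + (1 + 2 * b') * (gamma ^+ 2 * q)))).
    by rewrite ler_wpM2l ?subr_ge0//; lra.
  rewrite mulrDr !mulrA lerD ?ler_wpM2r//; nra.
(* Balance of the remaining terms, with [r = x - w]: the spare [gamma / 2 * |v|^2] covers
   [gamma / 8 + gamma / 16] times [|v|^2], and the contraction [L * alpha / 4 * |r|^2] covers
   [L * alpha / 16 * |r|^2] coming from [lip]. *)
have hgq : gamma * L * b' * (gamma * q) <= 1 / 8 * (gamma * q).
  by rewrite ler_wpM2r.
have hgp : gamma * L * (L * p) <= alpha / 8 * (L * p).
  by rewrite ler_wpM2r// mulr_ge0// ltW.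
have hq1 : gamma * L * (gamma * q) <= alpha / 8 * (gamma * q).
  by rewrite ler_wpM2r.
have hq2 : alpha * (gamma * q) <= gamma * q by rewrite ler_piMl.
have hlip : gamma * (a - b - (b - q)) <= gamma * (L ^+ 2 * p).
  by rewrite ler_wpM2l// ltW.
have hLX := ler_wpM2l (ltW L0) hX.
lra.
Qed.

(* If all [G t] exceeded [eps], [Psi] would decrease by at least
   [19 / 48 * gamma * eps] at each step and be negative at time [T]. *)
Lemma lyapunov_recursion (Psi G : nat -> R) (T : nat) gamma eps A D :
  0 < gamma -> 0 < eps -> 0 <= A -> (0 < T)%N ->
  A * T%:R <= 1 / 2 -> 2 * A * D <= gamma * eps / 16 ->
  Psi 0%N <= gamma * T%:R * eps / 48 -> 0 <= Psi T ->
  (forall t, (t < T)%N -> Psi t.+1 + gamma / 2 * G t <=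
     (1 + 4 * A) * Psi t + 2 * A * D) ->
  exists2 t, (t < T)%N & G t <= eps.
Proof.
move=> g0 e0 A0 T0 AT AD P0 PT step.
apply: contrapT => noG; have {}noG t : (t < T)%N -> eps < G t.
  by move=> tT; rewrite ltNge; apply/negP => Gt; apply: noG; exists t.
have ge0 : 0 < gamma * eps by rewrite mulr_gt0.
have T0R : 0 < T%:R :> R by rewrite ltr0n.
(* Decrease per step, in units of [gamma * eps]: [1/2] from the gradient, less [4/96] from the
   growth [4 * A * Psi] and [1/16] from [2 * A * D], that is [19/48]. *)
have bound t : (t <= T)%N ->
    Psi t <= gamma * eps * (T%:R / 48 - t%:R * (19 / 48)).
  elim: t => [_|t IH tT]; first by apply: le_trans P0 _; lra.
  have {}IH := IH (ltnW tT); have := step t tT; have := noG t tT.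
  rewrite -[t.+1%:R]natr1; have : 0 <= t%:R :> R by [].
  move: (Psi t) (Psi t.+1) (G t) (t%:R : R) IH => p p' g u pu u0 eg st.
  (* A negative [p] is trivial; otherwise [p] is at most the initial bound, and [A * T <= 1 / 2]
     applies. *)
  have : A * p <= gamma * eps / 96.
    have [p_ge0|p_lt0] := leP 0 p; last first.
      by apply: (@le_trans _ _ 0); [rewrite nmulr_lle0|rewrite divr_ge0// ltW].
    have : p <= gamma * eps * (T%:R / 48) by nra.
    by move=> /(ler_wpM2l A0) /le_trans; apply; nra.
  have : gamma * eps <= gamma * g by rewrite ler_wpM2l ?ltW.
  lra.
by have := bound T (leqnn T); nra.
Qed.

End one_step.

(** * The iterates as functions of the seeds *)

Section iterates.
Context {R : realType} {d n : nat} {fi : 'I_n -> 'rV[R]_d -> R}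
  {CD : 'I_n -> stoch_map R d} {CP : stoch_map R d}
  {dO : measure_display} {Omega : measurableType dO} {P : probability Omega R}
  {xiD : nat -> forall i, {RV P >-> seed (CD i)}}
  {xiP : nat -> {RV P >-> seed CP}} {T : nat} {gamma : R} {x0 : 'rV[R]_d}.
Hypothesis xi_fresh : fresh_seeds xiD xiP T.

Let source (tk : 'I_T * option 'I_n) : set (set Omega) :=
  seed_events (fun t i => xiD t i : Omega -> _)
    (fun t => xiP t : Omega -> _) tk.1 tk.2.

Local Notation past J := (g_sigma_algebraType (sources source [set` J])).

Let source_preimageD (t : 'I_T) i A : measurable A ->
  source (t, Some i) (xiD t i @^-1` A).
Proof. by move=> mA; exists A => //; rewrite setTI. Qed.

Let source_preimageP (t : 'I_T) A : measurable A ->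
  source (t, None) (xiP t @^-1` A).
Proof. by move=> mA; exists A => //; rewrite setTI. Qed.

Let source_measurable k : source k `<=` measurable.
Proof.
by case: k => t [i|] _ [A mA <-]; exact: measurable_funP.
Qed.

Let sourceT k : source k setT.
Proof. by case: k => t [i|]; exists setT => //; rewrite preimage_setT setTI. Qed.

Let sourceI k : setI_closed (source k).
Proof.
by case: k => t [i|] _ _ [A mA <-] [B mB <-]; exists (A `&` B);
  rewrite ?preimage_setI ?setTI//; exact: measurableI.
Qed.

Let source_indep : mutually_independent P source.
Proof. by case: xi_fresh. Qed.

Let past_measurable (J : {set 'I_T * option 'I_n}) dE (E : measurableType dE)
    (Y : Omega -> E) :
  measurable_fun setT (Y : past J -> E) -> measurable_fun setT Y.
Proof.
move=> mY _ A mA; apply: (sources_measurable source_measurable (J := J)).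
exact: mY.
Qed.

Let past_sub (J K : {set 'I_T * option 'I_n}) dE (E : measurableType dE)
    (Y : Omega -> E) : J \subset K ->
  measurable_fun setT (Y : past J -> E) -> measurable_fun setT (Y : past K -> E).
Proof. by move=> JK mY _ A mA; apply: (sources_sub JK); exact: mY. Qed.

Let xiD_past (J : {set 'I_T * option 'I_n}) (t : 'I_T) i : (t, Some i) \in J ->
  measurable_fun setT (xiD t i : past J -> seed (CD i)).
Proof.
move=> tJ _ A mA; rewrite setTI; apply: sub_sigma_algebra.
by exists (t, Some i) => //; exact: source_preimageD.
Qed.

Let xiP_past (J : {set 'I_T * option 'I_n}) (t : 'I_T) : (t, None) \in J ->
  measurable_fun setT (xiP t : past J -> seed CP).
Proof.
move=> tJ _ A mA; rewrite setTI; apply: sub_sigma_algebra.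
by exists (t, None) => //; exact: source_preimageP.
Qed.

Let act_past (J : {set 'I_T * option 'I_n}) (C : stoch_map R d)
    (xi : Omega -> seed C) (V : Omega -> borel_rV R d) :
  measurable_fun setT (xi : past J -> seed C) ->
  measurable_fun setT (V : past J -> borel_rV R d) ->
  measurable_fun setT (fun om : past J => act C (xi om) (V om) : borel_rV R d).
Proof.
move=> mxi mV.
exact: (measurableT_comp (@act_measurable _ _ C) (measurable_fun_pair mxi mV)).
Qed.

Let x t om := (ef21p_dcgd fi xiD xiP gamma x0 t om).1.
Let w t om := (ef21p_dcgd fi xiD xiP gamma x0 t om).2.
Let c t i om : 'rV[R]_d := act (CD i) (xiD t i om) (grad (fi i) (w t om)).

Let xS t om : x t.+1 om = x t om - gamma *: (n%:R^-1 *: \sum_(i < n) c t i om).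
Proof. by rewrite /x /c /w /=; case: (ef21p_dcgd _ _ _ _ _ _ _). Qed.

Let wS t om : w t.+1 om = w t om + act CP (xiP t om) (x t.+1 om - w t om).
Proof. by rewrite xS /x /c /w /=; case: (ef21p_dcgd _ _ _ _ _ _ _). Qed.

(* [before t]: the seeds of the steps s < t; [during t] adds those of the workers
   at step t, so that it decides the argument of the compressor of the iterates. *)
Let before (t : nat) : {set 'I_T * option 'I_n} :=
  finset (fun k : 'I_T * option 'I_n => (k.1 < t)%N).
Let during (t : nat) : {set 'I_T * option 'I_n} :=
  finset (fun k : 'I_T * option 'I_n =>
    (k.1 < t)%N || (k.1 == t :> nat) && (k.2 != None)).

Variable M : R.
Hypothesis fi_smooth : forall i, smooth M (fi i).

Let grad_past (J : {set 'I_T * option 'I_n}) i (V : Omega -> borel_rV R d) :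
  measurable_fun setT (V : past J -> borel_rV R d) ->
  measurable_fun setT (fun om : past J => grad (fi i) (V om) : borel_rV R d).
Proof.
move=> mV; have [_ mg] := smooth_measurable (fi_smooth i).
exact: measurableT_comp mV.
Qed.

Let before_during (t : nat) : before t \subset during t.
Proof.
by apply/fintype.subsetP => k; rewrite !inE => kt; rewrite kt.
Qed.

Let during_before (t : nat) : during t \subset before t.+1.
Proof.
apply/fintype.subsetP => k; rewrite !inE => /orP[kt|/andP[/eqP -> _]] //.
exact: ltnW.
Qed.

(** [x t.+1] uses the worker seeds of step [t] but not [xiP t], so it is decided by [during t] and
    the seed of the iterate compressor is still fresh. *)
Let past_iterate_step (t : 'I_T) :
  measurable_fun setT (x t : past (before t) -> borel_rV R d) ->
  measurable_fun setT (w t : past (before t) -> borel_rV R d) ->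
  measurable_fun setT (x t.+1 : past (during t) -> borel_rV R d).
Proof.
move=> mx mw; rewrite (funext (xS t)).
apply: measurable_rVB; first exact: past_sub (before_during t) mx.
apply: measurable_rVZ; apply: measurable_rVZ; apply: measurable_rV_sum => i.
apply: act_past; first by apply: xiD_past; rewrite inE eqxx orbT.
apply: grad_past; exact: past_sub (before_during t) mw.
Qed.

(** Induction on [t]. The final iterate [t = T] is included, since it uses only seeds of steps below
    [T]. *)
Let past_iterates (t : nat) : (t <= T)%N ->
  measurable_fun setT (x t : past (before t) -> borel_rV R d) /\
  measurable_fun setT (w t : past (before t) -> borel_rV R d).
Proof.
elim: t => [_|t IH tT]; first by split; exact: measurable_cst.
have [mx mw] := IH (ltnW tT); pose t' := Ordinal tT.
have mx' : measurable_fun setT (x t.+1 : past (before t.+1) -> borel_rV R d).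
  by apply: past_sub (during_before t) _; exact: (@past_iterate_step t').
have mw' : measurable_fun setT (w t : past (before t.+1) -> borel_rV R d).
  apply: past_sub mw; exact: fintype.subset_trans (before_during t) (during_before t).
split=> //; rewrite (funext (wS t)); apply: measurable_rVD => //.
apply: act_past; last exact: measurable_rVB.
by apply: (@xiP_past _ t'); rewrite inE.
Qed.

Variables (L alpha omega fstar : R) (fistar : 'I_n -> R).
Hypothesis n_gt0 : (0 < n)%N.
Hypothesis f_smooth : smooth L (average fi).
Hypothesis L_gt0 : 0 < L.
Hypothesis M_ge0 : 0 <= M.
Hypothesis f_ge : forall y, fstar <= average fi y.
Hypothesis fi_ge : forall i y, fistar i <= fi i y.
Hypothesis alpha_gt0 : 0 < alpha.
Hypothesis alpha_le1 : alpha <= 1.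
Hypothesis omega_ge0 : 0 <= omega.
Hypothesis CD_U : forall i, unbiased_compressor omega (CD i).
Hypothesis CP_B : biased_compressor alpha CP.
Hypothesis gamma_gt0 : 0 < gamma.
Hypothesis gammaL : gamma * L <= alpha / 8.

Local Notation integrable X := (P.-integrable setT (EFin \o X)).

Let f := average fi.
Let Dstar := fstar - n%:R^-1 * \sum_(i < n) fistar i.
Let gap t om := f (x t om) - fstar.
Let lag t om := dot (w t om - x t om) (w t om - x t om).
Let gsq t om := dot (grad f (x t om)) (grad f (x t om)).
Let v t i om := grad (fi i) (w t om).
Let err t i om := c t i om - v t i om.
Let avg_err t om := n%:R^-1 *: \sum_(i < n) err t i om.

Let xS_err t om : x t.+1 om = x t om - gamma *: (grad f (w t om) + avg_err t om).
Proof.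
rewrite xS grad_average; last by move=> i y; exact: (fi_smooth i).1.
congr (_ - _ *: _); rewrite -scalerDr -big_split/=; congr (_ *: _).
by apply: eq_bigr => i _; rewrite /err addrC subrK.
Qed.

Let mx (t : nat) : (t <= T)%N -> measurable_fun setT (x t : Omega -> borel_rV R d).
Proof. by move=> /past_iterates[/past_measurable]. Qed.

Let mw (t : nat) : (t <= T)%N -> measurable_fun setT (w t : Omega -> borel_rV R d).
Proof. by move=> /past_iterates[_ /past_measurable]. Qed.

Let mgradf (V : Omega -> borel_rV R d) : measurable_fun setT V ->
  measurable_fun setT (fun om => grad f (V om) : borel_rV R d).
Proof.
by move=> mV; have [_ mg] := smooth_measurable f_smooth; exact: measurableT_comp mV.
Qed.

Let mgradi i (V : Omega -> borel_rV R d) : measurable_fun setT V ->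
  measurable_fun setT (fun om => grad (fi i) (V om) : borel_rV R d).
Proof.
move=> mV; have [_ mg] := smooth_measurable (fi_smooth i).
exact: measurableT_comp mV.
Qed.

Let mgap (t : nat) : (t <= T)%N -> measurable_fun setT (gap t).
Proof.
move=> tT; apply: measurable_funB => //.
by have [mf _] := smooth_measurable f_smooth; exact: measurableT_comp (mx tT).
Qed.

Let gap_w t om : f (w t om) - fstar <= 2 * gap t om + L * lag t om.
Proof. exact: gap_shift. Qed.

(** * Expectations over one iteration *)

Section one_iteration.
Variable t : 'I_T.
Hypothesis gap_int : integrable (gap t).
Hypothesis lag_int : integrable (lag t).

Let tT : (t <= T)%N. Proof. exact: ltnW. Qed.

Let sum_v_le om : \sum_(i < n) dot (v t i om) (v t i om) <=
  2 * M * n%:R * (2 * gap t om + L * lag t om + Dstar).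
Proof.
apply: le_trans (sum_grad_le_gap fstar (w t om) n_gt0 M_ge0 fi_smooth fi_ge) _.
by rewrite ler_wpM2l ?mulr_ge0// lerD2r gap_w.
Qed.

Let bound_int a b e : integrable (fun om => a * (b * gap t om + e * lag t om + Dstar)).
Proof.
apply: integrable_EFinZ; apply: integrable_EFinD; last exact: integrable_EFin_cst.
by apply: integrable_EFinD; exact: integrable_EFinZ.
Qed.

Let v_sq i : square_integrable P (v t i).
Proof.
apply: square_integrable_le (bound_int _ 2 L); first exact/mgradi/mw.
move=> om; apply: le_trans (sum_v_le om).
by rewrite (bigD1 i)//= lerDl sumr_ge0// => j _; exact: dot_ge0.
Qed.

Let mc i : measurable_fun setT (c t i : Omega -> borel_rV R d).
Proof.
exact: (measurableT_comp (@act_measurable _ _ (CD i))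
  (measurable_fun_pair (@measurable_funP _ _ _ _ _ (xiD t i)) (mgradi i (mw tT)))).
Qed.

(** Stated in extended reals because the integrability of the error, [err_sq], is deduced from
    it. *)
Let err_le i : (\int[P]_om (dot (err t i om) (err t i om))%:E <=
  omega%:E * \int[P]_om (dot (v t i om) (v t i om))%:E)%E.
Proof.
apply: (@integral_error_le _ _ _ _ P (CD i) (xiD t i) (v t i)) => //.
- exact/mgradi/mw.
- by move=> y; exact: (CD_U i y).2.
apply: (@past_independent _ _ _ _ _ _ source_measurable sourceT sourceI
  source_indep _ _ _ _ _ _ _ (before t) (t, Some i)).
- by rewrite inE ltnn.
- by move=> A mA; exact: source_preimageD.
- by move=> A mA; case: xi_fresh => h _ _; exact: h.
- apply: grad_past; exact: (past_iterates tT).2.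
Qed.

Let err_sq i : square_integrable P (err t i).
Proof.
have merr : measurable_fun setT (err t i : Omega -> borel_rV R d).
  by apply: measurable_rVB => //; exact/mgradi/mw.
split=> //; apply/integrableP; split; first exact/measurable_EFinP/measurable_dot.
under eq_integral do rewrite /= ger0_norm ?dot_ge0//.
apply: le_lt_trans (err_le i) _.
by rewrite (EFin_Rintegral (v_sq i).2) -EFinM ltry.
Qed.

Let E_err_le i : \int[P]_om dot (err t i om) (err t i om) <=
  omega * \int[P]_om dot (v t i om) (v t i om).
Proof.
have := err_le i; rewrite (EFin_Rintegral (v_sq i).2) (EFin_Rintegral (err_sq i).2).
by rewrite -EFinM lee_fin.
Qed.

(** A general [J] covers two uses: [before t] for vectors known before step [t], and [before t] with
    the seed of one other worker for the cross terms. *)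
Let E_dot_err (J : {set 'I_T * option 'I_n}) (U : Omega -> borel_rV R d) i :
  before t \subset J -> (t, Some i) \notin J -> square_integrable P U ->
  measurable_fun setT (U : past J -> borel_rV R d) ->
  \int[P]_om dot (U om) (err t i om) = 0.
Proof.
move=> tJ iJ sU mU; apply: EFin_inj.
have iUe := integrable_dot sU (err_sq i).
rewrite -(EFin_Rintegral iUe).
apply: (@integral_dot_error_eq0 _ _ _ _ P (CD i) (xiD t i) U (v t i) _ _ _ omega) => //.
- exact/mgradi/mw.
- exact: sU.1.
apply: (@past_independent _ _ _ _ _ _ source_measurable sourceT sourceI
  source_indep _ _ _ _ _ _ _ J (t, Some i)) => //.
- by move=> A mA; exact: source_preimageD.
- by move=> A mA; case: xi_fresh => h _ _; exact: h.
- apply: measurable_fun_pair => //.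
  by apply: grad_past; apply: past_sub tJ (past_iterates tT).2.
Qed.

Let err_past i : measurable_fun setT
  (err t i : past (before t :|: finset.set1 (t, Some i)) -> borel_rV R d).
Proof.
have mv : measurable_fun setT
    (w t : past (before t :|: finset.set1 (t, Some i)) -> borel_rV R d).
  by apply: past_sub (past_iterates tT).2; exact: finset.subsetUl.
apply: measurable_rVB; last exact: grad_past.
apply: act_past; last exact: grad_past.
by apply: xiD_past; rewrite !inE eqxx orbT.
Qed.

(** The error of worker [j] is decided by the past and the seed of [j]; relative to these, the seed
    of [i] is fresh. *)
Let E_err_err i j : j != i -> \int[P]_om dot (err t j om) (err t i om) = 0.
Proof.
move=> ji.
apply: (@E_dot_err (before t :|: finset.set1 (t, Some j)) (err t j) i) => //.
  exact: finset.subsetUl.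
by rewrite !inE ltnn/= xpair_eqE eqxx/= eq_sym.
Qed.

Let E_avg_err_sq : \int[P]_om dot (avg_err t om) (avg_err t om) =
  n%:R^-1 ^+ 2 * \sum_(i < n) \int[P]_om dot (err t i om) (err t i om).
Proof.
have idot i j : integrable (fun om => dot (err t i om) (err t j om)).
  exact: integrable_dot.
have avgE om : dot (avg_err t om) (avg_err t om) = n%:R^-1 ^+ 2 *
    \sum_(i < n) \sum_(j < n) dot (err t i om) (err t j om).
  rewrite dotZl dotZr mulrA -expr2 dot_suml; congr (_ * _).
  by apply: eq_bigr => i _; rewrite dot_sumr.
under eq_Rintegral do rewrite avgE.
rewrite RintegralZl//; last first.
  by apply: integrable_EFin_sum => i; exact: integrable_EFin_sum.
congr (_ * _); rewrite Rintegral_sum; last first.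
  by move=> i; exact: integrable_EFin_sum.
apply: eq_bigr => i _; rewrite Rintegral_sum// (bigD1 i)//= big1 ?addr0//.
by move=> j ji; rewrite E_err_err// eq_sym.
Qed.

Let A := gamma ^+ 2 * L * M * omega / n%:R.

Let E_avg_err_le : L * gamma ^+ 2 * \int[P]_om dot (avg_err t om) (avg_err t om) <=
  2 * A * (2 * \int[P]_om gap t om + L * \int[P]_om lag t om + Dstar).
Proof.
have i1 := integrable_EFinZ 2 gap_int; have i2 := integrable_EFinZ L lag_int.
have sumv : \sum_(i < n) \int[P]_om dot (v t i om) (v t i om) <=
    2 * M * n%:R * (2 * \int[P]_om gap t om + L * \int[P]_om lag t om + Dstar).
  rewrite -Rintegral_sum; last by move=> i; exact: (v_sq i).2.
  apply: (@le_trans _ _ (\int[P]_om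
      (2 * M * n%:R * (2 * gap t om + L * lag t om + Dstar)))).
    apply: le_Rintegral => //.
    by apply: integrable_EFin_sum => i; exact: (v_sq i).2.
  rewrite RintegralZl//; last first.
    apply: integrable_EFinD; last exact: integrable_EFin_cst.
    exact: integrable_EFinD.
  rewrite RintegralD//; [|exact: integrable_EFinD|exact: integrable_EFin_cst].
  by rewrite RintegralD// !RintegralZl// RintegralTcst.
rewrite E_avg_err_sq.
have nR : 0 < n%:R :> R by rewrite ltr0n.
have sume := ler_sum (P := xpredT) (index_enum _) (fun i (_ : xpredT i) => E_err_le i).
rewrite -mulr_sumr in sume.
have Lg0 : 0 <= L * gamma ^+ 2 * n%:R^-1 ^+ 2.
  by rewrite !mulr_ge0 ?sqr_ge0// ltW.
rewrite mulrA; apply: le_trans (ler_wpM2l Lg0 sume) _.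
rewrite mulrA; apply: le_trans (ler_wpM2l _ sumv) _; first exact: mulr_ge0.
(* The [n^-2] of the averaged error meets the [n] of the summed gradient bound, which leaves the
   [1 / n] in [A]. *)
rewrite mulrA (_ : _ * (2 * M * n%:R) = 2 * A)//.
by rewrite /A; field; rewrite gt_eqF.
Qed.

(** The vector paired with the error in [lyapunov_step]. It is decided by [before t], hence
    orthogonal in mean to the errors of step [t]. *)
Let U om := (L * gamma ^+ 2) *: grad f (w t om) - gamma *: grad f (x t om) -
  ((1 - alpha) * L * gamma) *: (x t om - w t om - gamma *: grad f (w t om)).

Let Y om := x t.+1 om - w t om.

Let sq_gw : square_integrable P (fun om => grad f (w t om)).
Proof.
apply: (square_integrable_le (X := fun om => 2 * L * (2 * gap t om + L * lag t om))).
- exact/mgradf/mw.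
- move=> om; apply: le_trans (grad_le_gap _ (ltW L_gt0) f_smooth f_ge) _.
  by rewrite ler_wpM2l ?mulr_ge0 ?(ltW L_gt0)//; exact: gap_w.
- by apply: integrable_EFinZ; apply: integrable_EFinD; exact: integrable_EFinZ.
Qed.

Let sq_gx : square_integrable P (fun om => grad f (x t om)).
Proof.
apply: (square_integrable_le (X := fun om => 2 * L * gap t om)).
- exact/mgradf/mx.
- by move=> om; exact: (grad_le_gap _ (ltW L_gt0) f_smooth f_ge).
- exact: integrable_EFinZ.
Qed.

Let sq_xw : square_integrable P (fun om => x t om - w t om).
Proof.
apply: (square_integrable_le (X := lag t)) => //.
- by apply: measurable_rVB; [exact: mx|exact: mw].
- by move=> om; rewrite -[x t om - w t om]opprB dotNl dotNr opprK.
Qed.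

Let sq_avg_err : square_integrable P (avg_err t).
Proof. by apply: square_integrableZ; exact: square_integrable_sum. Qed.

Let sq_U : square_integrable P U.
Proof.
apply: square_integrableB.
  by apply: square_integrableB; exact: square_integrableZ.
apply: square_integrableZ; apply: square_integrableB => //.
exact: square_integrableZ.
Qed.

Let U_past : measurable_fun setT (U : past (before t) -> borel_rV R d).
Proof.
have [mxp mwp] := past_iterates tT.
have mg (V : Omega -> borel_rV R d) :
    measurable_fun setT (V : past (before t) -> borel_rV R d) ->
    measurable_fun setT (fun om : past (before t) => grad f (V om) : borel_rV R d).
  by move=> mV; have [_ mgf] := smooth_measurable f_smooth; exact: measurableT_comp mV.
have mgw := mg _ mwp; have mgx := mg _ mxp.
apply: measurable_rVB; first by apply: measurable_rVB; exact: measurable_rVZ.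
apply: measurable_rVZ; apply: measurable_rVB; first exact: measurable_rVB.
exact: measurable_rVZ.
Qed.

Let E_U_avg_err : \int[P]_om dot (U om) (avg_err t om) = 0.
Proof.
have UE om : dot (U om) (avg_err t om) =
    n%:R^-1 * \sum_(i < n) dot (U om) (err t i om).
  by rewrite dotZr dot_sumr.
under eq_Rintegral do rewrite UE.
have iUe i : integrable (fun om => dot (U om) (err t i om)) by exact: integrable_dot.
rewrite RintegralZl//; last exact: integrable_EFin_sum.
rewrite Rintegral_sum// big1 ?mulr0// => i _.
by apply: (@E_dot_err (before t) U i) => //; rewrite inE ltnn.
Qed.

Let sq_Y : square_integrable P Y.
Proof.
have -> : Y = fun om => x t om - w t om - gamma *: (grad f (w t om) + avg_err t om).
  by apply/funext => om; rewrite /Y xS_err addrAC.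
by apply: square_integrableB => //; apply/square_integrableZ/square_integrableD.
Qed.

(** Since [x t.+1 = w t + Y] and [w t.+1 = w t + C(Y)], the new lag is exactly the squared
    compression error at [Y]. *)
Let lagS om : lag t.+1 om =
  dot (act CP (xiP t om) (Y om) - Y om) (act CP (xiP t om) (Y om) - Y om).
Proof.
rewrite /lag wS -/(Y om); have -> : w t om + act CP (xiP t om) (Y om) - x t.+1 om =
    act CP (xiP t om) (Y om) - Y om; last by [].
by rewrite /Y opprB addrA (addrC (w t om)).
Qed.

(** [Y] involves the worker seeds of step [t], so the freshness of [xiP t] is taken relative to
    [during t]. *)
Let lagS_le : (\int[P]_om (lag t.+1 om)%:E <=
  (1 - alpha)%:E * \int[P]_om (dot (Y om) (Y om))%:E)%E.
Proof.
under eq_integral do rewrite lagS.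
apply: (@integral_error_le _ _ _ _ P CP (xiP t) Y) => //.
- exact: sq_Y.1.
- by rewrite subr_ge0.
apply: (@past_independent _ _ _ _ _ _ source_measurable sourceT sourceI
  source_indep _ _ _ _ _ _ _ (during t) (t, None)).
- by rewrite inE ltnn/= andbF.
- by move=> B mB; exact: source_preimageP.
- by move=> B mB; case: xi_fresh => _ h _; exact: h.
have [mxp mwp] := past_iterates tT.
apply: measurable_rVB; first exact: past_iterate_step.
exact: past_sub (before_during t) mwp.
Qed.

Let lagS_int : integrable (lag t.+1).
Proof.
apply/integrableP; split.
  apply/measurable_EFinP; apply: measurable_dot; apply: measurable_rVB;
    by [exact: mw|exact: mx].
under eq_integral do rewrite /= ger0_norm ?dot_ge0//.
by apply: le_lt_trans lagS_le _; rewrite (EFin_Rintegral sq_Y.2) -EFinM ltry.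
Qed.

(** [lyapunov_step] in expectation. Integrability at step [t.+1] belongs to the conclusion so that
    the lemma can be iterated. *)
Lemma expected_lyapunov_step : [/\ integrable (gap t.+1), integrable (lag t.+1),
  integrable (gsq t) &
  \int[P]_om gap t.+1 om + L / 2 * \int[P]_om lag t.+1 om +
    gamma / 2 * \int[P]_om gsq t om <=
  (1 + 4 * A) * (\int[P]_om gap t om + L / 2 * \int[P]_om lag t om) + 2 * A * Dstar].
Proof.
(* [W] and [Z] are the two sides of the pathwise inequality. [Z] carries [(1 - alpha) * |Y|^2] in
   place of the new lag, which it bounds only in expectation. *)
pose W om := gap t om + L / 2 * lag t om +
  L * gamma ^+ 2 * dot (avg_err t om) (avg_err t om) + dot (U om) (avg_err t om).
pose Z om := gap t.+1 om + L / 2 * ((1 - alpha) * dot (Y om) (Y om)) +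
  gamma / 2 * gsq t om.
have ZW om : Z om <= W om.
  have := lyapunov_step (x t om) (w t om) (avg_err t om) f_smooth L_gt0 alpha_gt0
    alpha_le1 gamma_gt0 gammaL.
  rewrite /= -xS_err -/(Y om) -/(lag t om) -/(gsq t om) -/(U om) -/f /Z /W /gap; lra.
have iUa : integrable (fun om => dot (U om) (avg_err t om)) by exact: integrable_dot.
have iaa := integrable_EFinZ (L * gamma ^+ 2) sq_avg_err.2.
have ilag := integrable_EFinZ (L / 2) lag_int.
have i2 := integrable_EFinD gap_int ilag.
have i3 := integrable_EFinD i2 iaa.
have iW : integrable W := integrable_EFinD i3 iUa.
have iY := integrable_EFinZ (L / 2) (integrable_EFinZ (1 - alpha) sq_Y.2).
have iG := integrable_EFinZ (gamma / 2) sq_gx.2.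
have gap0 om : 0 <= gap t.+1 om by rewrite subr_ge0.
have Y0 om : 0 <= L / 2 * ((1 - alpha) * dot (Y om) (Y om)).
  by rewrite !mulr_ge0 ?subr_ge0 ?dot_ge0// ltW.
have G0 om : 0 <= gamma / 2 * gsq t om.
  by rewrite !mulr_ge0 ?dot_ge0// ltW.
(* All three terms of [Z] are nonnegative, so [0 <= gap t.+1 <= Z <= W] with [W] integrable. *)
have iS : integrable (gap t.+1).
  apply: (integrable_le (Y := W)) => //; first exact: mgap.
  move=> om; rewrite ger0_norm//; apply: le_trans (ZW om).
  by rewrite /Z; have := Y0 om; have := G0 om; lra.
have iSY := integrable_EFinD iS iY.
have iZ : integrable Z := integrable_EFinD iSY iG.
split=> //; first exact: sq_gx.2.
have : \int[P]_om Z om <= \int[P]_om W om by exact: le_Rintegral.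
have -> : \int[P]_om Z om = \int[P]_om gap t.+1 om +
    L / 2 * ((1 - alpha) * \int[P]_om dot (Y om) (Y om)) +
    gamma / 2 * \int[P]_om gsq t om.
  rewrite /Z RintegralD// RintegralD// RintegralZl//; last first.
    exact: integrable_EFinZ sq_Y.2.
  by rewrite RintegralZl ?RintegralZl//; [exact: sq_Y.2|exact: sq_gx.2].
have -> : \int[P]_om W om = \int[P]_om gap t om + L / 2 * \int[P]_om lag t om +
    L * gamma ^+ 2 * \int[P]_om dot (avg_err t om) (avg_err t om).
  rewrite /W RintegralD// E_U_avg_err addr0 RintegralD// RintegralD//.
  by rewrite !RintegralZl//; exact: sq_avg_err.2.
have lagE : \int[P]_om lag t.+1 om <= (1 - alpha) * \int[P]_om dot (Y om) (Y om).
  have := lagS_le; rewrite (EFin_Rintegral sq_Y.2) (EFin_Rintegral lagS_int).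
  by rewrite -EFinM lee_fin.
have hL : 0 <= L / 2 by rewrite divr_ge0// ltW.
(* The error contributes [2 * A * (2 * gap + L * lag + Dstar)], that is [4 * A] times the Lyapunov
   function plus [2 * A * Dstar]. *)
have := ler_wpM2l hL lagE; have := E_avg_err_le.
lra.
Qed.

End one_iteration.

(** The hypotheses are the consequences of the stepsize and of the bound on [T] that
    [lyapunov_recursion] consumes, free of minima and of zero denominators. *)
Lemma exists_small_expected_gradient (eps : R) :
  (0 < T)%N -> 0 < eps ->
  gamma ^+ 2 * L * M * omega / n%:R * T%:R <= 1 / 2 ->
  2 * (gamma ^+ 2 * L * M * omega / n%:R) * Dstar <= gamma * eps / 16 ->
  f x0 - fstar <= gamma * T%:R * eps / 48 ->
  exists t : 'I_T, ('E_P[(fun om => (enorm (grad f (x t om)) ^+ 2)%R)] <= eps%:E)%E.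
Proof.
move=> T0 eps0 AT AD gap0_le.
(* Integrability propagates from the deterministic start, where the lag is zero because both
   sequences begin at [x0]. *)
have int (t : nat) : (t <= T)%N -> integrable (gap t) /\ integrable (lag t).
  elim: t => [_|t IH tT].
    have lag0 : lag 0 = fun=> 0 by apply/funext => om; rewrite /lag subrr dot0l.
    rewrite lag0; split; last exact: integrable_EFin_cst.
    exact: (integrable_EFin_cst P (f x0 - fstar)).
  have [ig il] := IH (ltnW tT).
  by have [] := expected_lyapunov_step (t := Ordinal tT) ig il.
have Psi_ge0 (t : nat) : 0 <= \int[P]_om gap t om + L / 2 * \int[P]_om lag t om.
  rewrite addr_ge0 ?mulr_ge0 ?invr_ge0 ?(ltW L_gt0)//.
    by apply: Rintegral_ge0 => om _; rewrite subr_ge0.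
  by apply: Rintegral_ge0 => om _; exact: dot_ge0.
have [|||t tT Gt] := lyapunov_recursion
    (Psi := fun t => \int[P]_om gap t om + L / 2 * \int[P]_om lag t om)
    (G := fun t => \int[P]_om gsq t om)
    gamma_gt0 eps0 _ T0 AT AD _ (Psi_ge0 T) _.
- by rewrite divr_ge0 ?mulr_ge0 ?(ltW L_gt0) ?(ltW gamma_gt0)// ?(ltW gamma_gt0).
- have gapE : \int[P]_om gap 0 om = f x0 - fstar := RintegralTcst P (f x0 - fstar).
  have lagE : \int[P]_om lag 0 om = 0.
    rewrite -[RHS](RintegralTcst P 0).
    by apply: eq_Rintegral => om _; rewrite /lag subrr dot0l.
  by rewrite /= gapE lagE mulr0 addr0.
- move=> t tT; have [ig il] := int t (ltnW tT).
  by have [_ _ _] := expected_lyapunov_step (t := Ordinal tT) ig il.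
exists (Ordinal tT); have [ig il] := int t (ltnW tT).
have [_ _ iG _] := expected_lyapunov_step (t := Ordinal tT) ig il.
rewrite unlock; under eq_integral do rewrite sqr_enorm.
by rewrite (EFin_Rintegral iG) lee_fin.
Qed.

End iterates.

(** * Consequences of the stepsize formula and of the number of iterations *)

Lemma efrac_bound (R : realType) (gamma a b : R) : (gamma%:E <= efrac a b)%E ->
  b = 0 \/ b != 0 /\ gamma <= a / b.
Proof. by rewrite /efrac; case: eqVneq => [|b0]; [left|rewrite lee_fin; right]. Qed.

(** A real stepsize cannot equal [+oo], so a term that attains the minimum has a nonzero
    denominator. *)
Lemma efrac_eq (R : realType) (gamma a b : R) : gamma%:E = efrac a b ->
  b != 0 /\ gamma * b = a.
Proof.
by rewrite /efrac; case: eqVneq => // b0 [->]; rewrite divfK.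
Qed.

Theorem theorem6p2 (R : realType) (d n : nat) (n_gt0 : (0 < n)%N)
  (fi : 'I_n -> 'rV[R]_d -> R) (L : R) (Li : 'I_n -> R)
  (fstar : R) (fistar : 'I_n -> R)
  (L_smooth : smoothness_constant (average fi) L)
  (Li_smooth : forall i, smoothness_constant (fi i) (Li i))
  (f_ge : forall x, fstar <= average fi x)
  (fi_ge : forall i x, fistar i <= fi i x)
  (eps : R) (eps_gt0 : 0 < eps)
  (alpha : R) (alpha_gt0 : 0 < alpha) (alpha_le1 : alpha <= 1)
  (omega : R) (omega_ge0 : 0 <= omega)
  (CD : 'I_n -> stoch_map R d) (CP : stoch_map R d)
  (CD_U : forall i, unbiased_compressor omega (CD i))
  (CP_B : biased_compressor alpha CP)
  (T : nat) (T_gt0 : (0 < T)%N)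
  (dO : measure_display) (Omega : measurableType dO)
  (P : probability Omega R)
  (xiD : nat -> forall i, {RV P >-> seed (CD i)})
  (xiP : nat -> {RV P >-> seed CP})
  (xi_fresh : fresh_seeds xiD xiP T)
  (x0 : 'rV[R]_d) (gamma : R) (gamma_gt0 : 0 < gamma) :
  let f := average fi in
  let Lmax := \big[Num.max/0]_(i < n) Li i in
  let Delta0 := f x0 - fstar in
  let Deltastar := fstar - n%:R^-1 * \sum_(i < n) fistar i in
  let x := fun t om => (ef21p_dcgd fi xiD xiP gamma x0 t om).1 in
  gamma%:E =
    mine (efrac alpha (8 * L))
      (mine (efrac (Num.sqrt n%:R)
                   (Num.sqrt (2 * omega * L * Lmax * T%:R)))
            (efrac (n%:R * eps) (32 * Deltastar * omega * L * Lmax))) ->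
  48 * Delta0 * L / eps *
    Num.max (8 / alpha)
      (Num.max (96 * Delta0 * omega * Lmax / (n%:R * eps))
               (32 * Deltastar * omega * Lmax / (n%:R * eps))) <= T%:R ->
  (\big[mine/+oo]_(t < T) 'E_P[(fun om => (enorm (grad f (x t om)) ^+ 2)%R)]
     <= eps%:E)%E.
Proof.
move=> f Lmax Delta0 Deltastar x gammaE T_ge.
have [g1 g2 g3] : [/\ (gamma%:E <= efrac alpha (8 * L))%E,
    (gamma%:E <= efrac (Num.sqrt n%:R) (Num.sqrt (2 * omega * L * Lmax * T%:R)))%E &
    (gamma%:E <= efrac (n%:R * eps) (32 * Deltastar * omega * L * Lmax))%E].
  by move: (lexx gamma%:E); rewrite {2}gammaE !le_min => /and3P[].
have nR : 0 < n%:R :> R by rewrite ltr0n.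
have TR : 0 < T%:R :> R by rewrite ltr0n.
have Delta0_ge0 : 0 <= Delta0 by rewrite subr_ge0.
have Lmax_ge0 : 0 <= Lmax by exact: bigmax_ge_id.
(* [L = 0] would make all three terms [+oo], against the finiteness of [gamma]; [L < 0] would make
   the first one negative. *)
have L_gt0 : 0 < L.
  case: (efrac_bound g1) => [/eqP|[_ g1']].
    rewrite mulf_eq0 pnatr_eq0/= => /eqP L0; move: gammaE.
    by rewrite L0 /efrac !(mulr0, mul0r) sqrtr0 eqxx.
  have : 0 < alpha / (8 * L) := lt_le_trans gamma_gt0 g1'.
  by rewrite pmulr_rgt0// invr_gt0 pmulr_rgt0.
have gL : gamma * L <= alpha / 8.
  case: (efrac_bound g1) => [L0|[_]]; first by move: L_gt0; lra.
  by rewrite ler_pdivlMr ?mulr_gt0//; lra.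
set A := gamma ^+ 2 * L * Lmax * omega / n%:R.
have oLL_ge0 : 0 <= 2 * omega * L * Lmax * T%:R.
  by rewrite !mulr_ge0// ltW.
have AT : A * T%:R <= 1 / 2.
  have -> : A * T%:R = gamma ^+ 2 * (2 * omega * L * Lmax * T%:R) / (2 * n%:R).
    by rewrite /A; field; rewrite gt_eqF.
  rewrite ler_pdivrMr ?mulr_gt0// (_ : 1 / 2 * (2 * n%:R) = n%:R); last by field.
  (* A zero root means a zero radicand, since the latter is nonnegative, and the bound is then
     trivial; otherwise the second stepsize bound is squared. *)
  case: (efrac_bound g2) => [S0|[S0 g2']].
    have -> : 2 * omega * L * Lmax * T%:R = 0.
      by apply/eqP; rewrite eq_le oLL_ge0 andbT -sqrtr_eq0 S0.
    by rewrite mulr0.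
  have S_gt0 : 0 < Num.sqrt (2 * omega * L * Lmax * T%:R).
    by rewrite lt_neqAle eq_sym S0 sqrtr_ge0.
  move: g2'; rewrite ler_pdivlMr// => g2'.
  rewrite -[X in _ * X]sqr_sqrtr// -exprMn -[leRHS]sqr_sqrtr//.
  by rewrite ler_sqr ?nnegrE ?sqrtr_ge0// mulr_ge0 ?ltW.
have AD : 2 * A * Deltastar <= gamma * eps / 16.
  have AE : 2 * A * Deltastar = gamma / (16 * n%:R) *
      (gamma * (32 * Deltastar * omega * L * Lmax)).
    by rewrite /A; field; rewrite gt_eqF.
  have gn : 0 <= gamma / (16 * n%:R) by rewrite divr_ge0 ?mulr_ge0// ltW.
  have g_eps : gamma * (32 * Deltastar * omega * L * Lmax) <= n%:R * eps.
    case: (efrac_bound g3) => [->|[_ g3']]; first by rewrite mulr0 mulr_ge0// ltW.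
    (* [fstar] is an arbitrary lower bound, so [Deltastar] may be negative; the left side is then
       nonpositive. *)
    have [D0|D0] := leP (32 * Deltastar * omega * L * Lmax) 0.
      apply: (@le_trans _ _ 0); last by rewrite mulr_ge0// ltW.
      by rewrite mulr_ge0_le0// ltW.
    by rewrite -ler_pdivlMr.
  rewrite AE; apply: le_trans (ler_wpM2l gn g_eps) _.
  by rewrite le_eqVlt; apply/orP; left; apply/eqP; field; rewrite gt_eqF.
have gap_le : Delta0 <= gamma * T%:R * eps / 48.
  have coef_ge0 : 0 <= 48 * Delta0 * L / eps.
    by rewrite divr_ge0 ?mulr_ge0// ltW.
  have [T1 T2 T3] : [/\ 48 * Delta0 * L / eps * (8 / alpha) <= T%:R,
      48 * Delta0 * L / eps * (96 * Delta0 * omega * Lmax / (n%:R * eps)) <= T%:R &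
      48 * Delta0 * L / eps * (32 * Deltastar * omega * Lmax / (n%:R * eps)) <= T%:R].
    by split; apply: le_trans T_ge; rewrite ler_wpM2l// !le_max lexx ?orbT.
  (* A lower bound on [gamma] is needed here, so the argument splits on the term that attains the
     minimum and uses the matching term of the bound on [T]. *)
  have [gE|[gE|gE]] : gamma%:E = efrac alpha (8 * L) \/
      gamma%:E = efrac (Num.sqrt n%:R) (Num.sqrt (2 * omega * L * Lmax * T%:R)) \/
      gamma%:E = efrac (n%:R * eps) (32 * Deltastar * omega * L * Lmax).
    move: gammaE; rewrite {1}/Order.min; case: ifP => _ ->; first by left.
    by rewrite /Order.min; case: ifP => _; right; [left|right].
  - have [_ gE'] := efrac_eq gE.
    have : 48 * Delta0 * L / eps * (8 / alpha) = 48 * Delta0 / (gamma * eps).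
      by rewrite -gE'; field; rewrite !gt_eqF.
    move: T1 => /[swap] ->; rewrite ler_pdivrMr ?mulr_gt0//; lra.
  - have [S0 /(congr1 (fun z => z ^+ 2))] := efrac_eq gE.
    rewrite exprMn !sqr_sqrtr// => gE'.
    (* Here [n = gamma^2 * 2 * omega * L * Lmax * T], so the bound on [T] is quadratic in
       [gamma * T]. The claim is squared and multiplied by [2 * omega * L * Lmax]; the constants
       match as [48 * 96 = 2 * 48^2]. *)
    rewrite -(@ler_pXn2r _ 2) ?nnegrE//; last first.
      by rewrite divr_ge0 ?mulr_ge0 ?(ltW gamma_gt0) ?(ltW eps_gt0).
    have K_gt0 : 0 < omega * L * Lmax.
      rewrite lt_neqAle !mulr_ge0 ?(ltW L_gt0)// andbT eq_sym.
      apply: contra S0 => /eqP K0.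
      rewrite (_ : 2 * omega * L * Lmax * T%:R = 2 * (omega * L * Lmax) * T%:R).
        by rewrite K0 mulr0 mul0r sqrtr0.
      by rewrite !mulrA.
    have K2_gt0 : 0 < 2 * (omega * L * Lmax) by rewrite mulr_gt0.
    rewrite -(ler_pM2l K2_gt0).
    move: T2; rewrite mulf_div ler_pdivrMr ?mulr_gt0// -gE'.
    by rewrite !exprMn exprVn; lra.
  - have [B0 gE'] := efrac_eq gE.
    have : 48 * Delta0 * L / eps * (32 * Deltastar * omega * Lmax / (n%:R * eps)) =
        48 * Delta0 / (gamma * eps).
      rewrite -gE' mulf_div; move: B0.
      rewrite (_ : 48 * Delta0 * L * (32 * Deltastar * omega * Lmax) =
        48 * Delta0 * (32 * Deltastar * omega * L * Lmax)); last by ring.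
      move: (32 * _ * _ * _ * _) => B B0; field.
      by rewrite B0 !gt_eqF.
    move: T3 => /[swap] ->; rewrite ler_pdivrMr ?mulr_gt0//; lra.
have fi_smooth i : smooth Lmax (fi i).
  apply: smooth_le (Li_smooth i).1; exact: le_bigmax.
have [t Gt] := exists_small_expected_gradient xi_fresh fi_smooth n_gt0 L_smooth.1
  L_gt0 Lmax_ge0 f_ge fi_ge alpha_gt0 alpha_le1 omega_ge0 CD_U CP_B gamma_gt0 gL
  T_gt0 eps_gt0 AT AD gap_le.
by apply: bigmin_inf Gt.
Qed.
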